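(* Let $P\in\mathcal{P}$ be a path and let $d_P:\Lambda\to\Lambda$ be the associated path operator. Then the symmetric function $\left.d_P(1)\right|_{q=q+1}$, obtained from $d_P(1)\in\Lambda$ by the substitution $q\mapsto q+1$, is $e$-positive.
   Context: $\Lambda$ is the algebra of symmetric functions in $x_1,x_2,\dots$ over $\mathbb{Q}(q,t)$, $e_r$ the elementary symmetric functions (with $e_0=1$), $p_r$ the power sums, $e_\mu=e_{\mu_1}e_{\mu_2}\cdots$ for a partition $\mu$. $f\in\Lambda$ is $e$-positive if all coefficients of its expansion in the basis $\{e_\mu\}_\mu$ lie in $\mathbb{N}[q,t]$ ($0\in\mathbb{N}$). For $k\ge 0$ let $V_k=\Lambda[y_1,\dots,y_k]$, so $V_0=\Lambda$. For $F=F[X]\in V_k$ and a variable $y$, the plethystic substitution $F[X\pm(q-1)y]$ is obtained by replacing each $p_r$ by $p_r\pm(q^r-1)y^r$, leaving the $y_i$'s in $F$ unchanged. For $k\ge2$ and $1\le i\le k-1$, define $T_i:V_k\to V_k$ by $$T_iF=\frac{(q-1)\,y_i\,F+(y_{i+1}-q\,y_i)\,s_iF}{y_{i+1}-y_i},$$ where $s_i$ exchanges $y_i$ and $y_{i+1}$. Define $d_+:V_k\to V_{k+1}$ for $k\ge0$ by $$d_+F=T_1T_2\cdots T_k\big(F[X+(q-1)y_{k+1}]\big),$$ $d_-:V_k\to V_{k-1}$ for $k\ge1$ by $$d_-F=-F[X-(q-1)y_k]\sum_{i\ge0}(-1/y_k)^ie_i[X]\Big|_{y_k^{-1}},$$ where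 $|_{y_k^{-1}}$ denotes taking the coefficient of $y_k^{-1}$, and $\varphi:V_k\to V_k$ for $k\ge1$ by $$\varphi=\frac1{q-1}(d_-d_+-d_+d_-).$$ $\mathcal{P}$ is the set of lattice paths from $(0,0)$ to $(n,n)$, for some $n\in\mathbb{N}$, made of north steps $(0,1)$, east steps $(1,0)$ and diagonal steps $(1,1)$, staying weakly above the line $y=x$ and having no diagonal step along the line $y=x$. A path is encoded by the word in $\{-,0,+\}$ obtained by reading its steps from $(0,0)$ to $(n,n)$ and writing $-$ for a north step, $0$ for a diagonal step, $+$ for an east step. The path operator $d_P:V_0\to V_0$ is obtained from this word by replacing each $-$ by $d_-$, each $0$ by $\varphi$, each $+$ by $d_+$, and composing these operators in the written order (the rightmost letter acts first). For example, the word $(-,-,0,0,+,0,+)$ gives $d_P=d_-d_-\varphi\varphi d_+\varphi d_+$. *)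

(* Defs.v *)
From HB Require Import structures.
From mathcomp Require Import all_boot all_order perm all_algebra generic_quotient.
From mathcomp Require Import boolp classical_sets.
From mathcomp Require Import mpoly.

Set Implicit Arguments.
Unset Strict Implicit.
Unset Printing Implicit Defensive.

Import GRing.Theory.

Local Open Scope ring_scope.

Section SymFun.
Variable R : comNzRingType.

Definition last0 n (p : {mpoly R[n.+1]}) : {mpoly R[n]} := (muni p).[0].

Fact last0D n : {morph @last0 n : p q / p + q}.
Proof. by move=> p q; rewrite /last0 (raddfD (@muni n R)) hornerD. Qed.
Fact last0N n : {morph @last0 n : p / - p}.
Proof. by move=> p; rewrite /last0 (raddfN (@muni n R)) hornerN. Qed.
Fact last0M n : {morph @last0 n : p q / p * q}.
Proof. by move=> p q; rewrite /last0 (rmorphM (@muni n R)) hornerM. Qed.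
Fact last0Z n c : {morph @last0 n : p / c *: p}.
Proof. by move=> p; rewrite /last0 muniZ hornerZ mul_mpolyC. Qed.

(* A symmetric function in x_1, x_2, ... is given by its truncations
   f(x_1, ..., x_n, 0, 0, ...), i.e. by a family of symmetric polynomials
   compatible with setting the last variable to 0, of bounded degree. *)
Definition is_symfun (f : forall n, {mpoly R[n]}) : Prop :=
  [/\ forall n, f n \is symmetric,
      forall n, last0 (f n.+1) = f n &
      exists d, forall n, (msize (f n) <= d)%N].

Record symfun := SymFun {
  trunc :> forall n, {mpoly R[n]};
  symfunP : is_symfun trunc }.

Lemma symfun_inj (f g : symfun) : (forall n, f n = g n) -> f = g.
Proof.
case: f g => [f fP] [g gP] /= fg.
have e : f = g by apply: functional_extensionality_dep.
by case: _ / e gP => gP; congr SymFun; exact: Prop_irrelevance.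
Qed.

HB.instance Definition _ := gen_eqMixin symfun.
HB.instance Definition _ := gen_choiceMixin symfun.

Lemma is_symfunC (c : R) : is_symfun (fun n => c%:MP_[n]).
Proof.
split=> [n|n|]; first by apply/issymP => s; rewrite /msym mmapC.
  by rewrite /last0 muniC hornerC.
by exists 1%N => n; rewrite msizeC; case: (c != 0).
Qed.

Lemma is_symfunD (f g : symfun) : is_symfun (fun n => f n + g n).
Proof.
case: f g => [f [fS fT [d fd]]] [g [gS gT [e ge]]]; split=> [n|n|] /=.
- by rewrite rpredD ?fS ?gS.
- by rewrite last0D fT gT.
exists (maxn d e) => n; apply: leq_trans (msizeD_le _ _) _.
by rewrite geq_max !leq_max fd ge orbT.
Qed.

Lemma is_symfunN (f : symfun) : is_symfun (fun n => - f n).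
Proof.
case: f => [f [fS fT [d fd]]]; split=> [n|n|] /=.
- by rewrite rpredN fS.
- by rewrite last0N fT.
by exists d => n; rewrite msizeN.
Qed.

Lemma is_symfunM (f g : symfun) : is_symfun (fun n => f n * g n).
Proof.
case: f g => [f [fS fT [d fd]]] [g [gS gT [e ge]]]; split=> [n|n|] /=.
- by rewrite rpredM ?fS ?gS.
- by rewrite last0M fT gT.
exists (d + e).+1 => n.
by apply: leq_trans (msizeM_le _ _) _; rewrite ltnS leq_add.
Qed.

Lemma is_symfunZ (c : R) (f : symfun) : is_symfun (fun n => c *: f n).
Proof.
case: f => [f [fS fT [d fd]]]; split=> [n|n|] /=.
- by rewrite rpredZ ?fS.
- by rewrite last0Z fT.
by exists d => n; apply: leq_trans (msizeZ_le _ _) _.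
Qed.

Definition sfC c := SymFun (is_symfunC c).
Definition sfD f g := SymFun (is_symfunD f g).
Definition sfN f := SymFun (is_symfunN f).
Definition sfM f g := SymFun (is_symfunM f g).
Definition sfZ c f := SymFun (is_symfunZ c f).

Fact sfDA : associative sfD.
Proof. by move=> f g h; apply: symfun_inj => n /=; rewrite addrA. Qed.
Fact sfDC : commutative sfD.
Proof. by move=> f g; apply: symfun_inj => n /=; rewrite addrC. Qed.
Fact sf0D : left_id (sfC 0) sfD.
Proof. by move=> f; apply: symfun_inj => n /=; rewrite mpolyC0 add0r. Qed.
Fact sfND : left_inverse (sfC 0) sfN sfD.
Proof. by move=> f; apply: symfun_inj => n /=; rewrite mpolyC0 addNr. Qed.

HB.instance Definition _ := GRing.isZmodule.Build symfun sfDA sfDC sf0D sfND.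

Fact sfMA : associative sfM.
Proof. by move=> f g h; apply: symfun_inj => n /=; rewrite mulrA. Qed.
Fact sfMC : commutative sfM.
Proof. by move=> f g; apply: symfun_inj => n /=; rewrite mulrC. Qed.
Fact sf1M : left_id (sfC 1) sfM.
Proof. by move=> f; apply: symfun_inj => n /=; rewrite mpolyC1 mul1r. Qed.
Fact sfMDl : left_distributive sfM +%R.
Proof. by move=> f g h; apply: symfun_inj => n /=; rewrite mulrDl. Qed.
Fact sf1_neq0 : sfC 1 != 0.
Proof.
apply/eqP => /(congr1 (fun f : symfun => f 0%N)) /= /eqP.
by rewrite mpolyC1 mpolyC0 oner_eq0.
Qed.

HB.instance Definition _ :=
  GRing.Zmodule_isComNzRing.Build symfun sfMA sfMC sf1M sfMDl sf1_neq0.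

Fact sfZA a b f : sfZ a (sfZ b f) = sfZ (a * b) f.
Proof. by apply: symfun_inj => n /=; rewrite scalerA. Qed.
Fact sf1Z : left_id 1 sfZ.
Proof. by move=> f; apply: symfun_inj => n /=; rewrite scale1r. Qed.
Fact sfZDr : right_distributive sfZ +%R.
Proof. by move=> a f g; apply: symfun_inj => n /=; rewrite scalerDr. Qed.
Fact sfZDl f : {morph sfZ^~ f : a b / a + b}.
Proof. by move=> a b; apply: symfun_inj => n /=; rewrite scalerDl. Qed.

HB.instance Definition _ :=
  GRing.Zmodule_isLmodule.Build R symfun sfZA sf1Z sfZDr sfZDl.

Fact sfZAl a (f g : symfun) : a *: (f * g) = a *: f * g.
Proof. by apply: symfun_inj => n /=; rewrite scalerAl. Qed.

HB.instance Definition _ := GRing.Lmodule_isLalgebra.Build R symfun sfZAl.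
HB.instance Definition _ := GRing.Lalgebra_isComAlgebra.Build R symfun.

Fact last0_mwiden n (p : {mpoly R[n]}) : last0 (mwiden p) = p.
Proof.
elim/mpolyind: p => [|c m p _ _ IH]; first by rewrite /last0 !raddf0 horner0.
rewrite mwidenD mwidenZ mwidenX last0D last0Z IH; congr (_ *: _ + _).
rewrite /last0 muniE msuppX big_seq1 mcoeffX eqxx scale1r.
rewrite mnmwiden_ordmax expr0 hornerZ hornerC mulr1.
by congr 'X_[_]; apply/mnmP => i; rewrite mnmE mnmwiden_widen.
Qed.

Fact last0_last n : last0 ('X_ord_max : {mpoly R[n.+1]}) = 0.
Proof.
rewrite /last0 muniE msuppX big_seq1 mcoeffX eqxx scale1r mnm1E eqxx expr1.
by rewrite hornerZ hornerX mulr0.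
Qed.

Lemma is_symfun_elem r : is_symfun (fun n => mesym n R r).
Proof.
split=> [n|n|]; first exact: mesym_sym.
  case: r => [|r]; first by rewrite !mesym0E /last0 muni1 hornerC.
  by rewrite mesymSS last0D last0M !last0_mwiden last0_last mulr0 addr0.
exists r.+1 => n; rewrite mesymE.
elim/big_ind: _ => [|p q pr qr|h /eqP <-]; first by rewrite msize0.
  by apply: leq_trans (msizeD_le _ _) _; rewrite geq_max pr.
by rewrite msizeX mdeg_mesym1.
Qed.

Lemma is_symfun_psum r : is_symfun (fun n => \sum_(i < n) 'X_i ^+ r.+1).
Proof.
split=> [n|n|].
- apply/issymP => s; rewrite raddf_sum /= [RHS](reindex_inj (@perm_inj _ s)).
  apply: eq_bigr => i _; rewrite (rmorphXn (@msym n R s)) /=; congr (_ ^+ _).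
  by rewrite /msym mmapX mmap1U.
- rewrite big_ord_recr last0D exprS last0M last0_last mul0r addr0.
  rewrite -[RHS]last0_mwiden; congr last0.
  rewrite raddf_sum; apply: eq_bigr => i _ /=.
  by rewrite (rmorphXn (@mwiden n R)) /= mwidenX mnmwiden1.
exists r.+2 => n; elim/big_ind: _ => [|p q pr qr|i _]; first by rewrite msize0.
  by apply: leq_trans (msizeD_le _ _) _; rewrite geq_max pr.
by rewrite mpolyXn msizeX mdegMn mdeg1 mul1n.
Qed.

Definition elem r : symfun := SymFun (is_symfun_elem r).

(* psum r is the power sum p_(r+1): with p_0 excluded, all of them are
   symmetric functions. *)
Definition psum r : symfun := SymFun (is_symfun_psum r).

End SymFun.

Definition Qqt := {fraction {mpoly rat[2]}}.
HB.instance Definition _ := GRing.Field.on Qqt.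

(* In {mpoly rat[2]}, the first variable is q and the second one is t. *)
Definition q : Qqt := tofrac 'X_ord0.

Definition t : Qqt := tofrac 'X_ord_max.

Definition Nqt : set Qqt :=
  [set c | exists2 p : {mpoly rat[2]}, p \is a mpolyOver 2 Num.nat & c = tofrac p].

(* The substitution q |-> q + 1, on Q[q,t] and on its field of fractions. *)
Definition shift_poly (p : {mpoly rat[2]}) : {mpoly rat[2]} :=
  p \mPo [tuple 'X_ord0 + 1; 'X_ord_max].

Definition shift_frac (x : Qqt) : Qqt :=
  tofrac (shift_poly (\n_(repr x))) / tofrac (shift_poly (\d_(repr x))).

Fact shift_polyK p :
  shift_poly p \mPo [tuple 'X_ord0 - 1; 'X_ord_max] = p.
Proof.
elim/mpolyind: p => [|c m p _ _ IH]; first by rewrite /shift_poly !comp_mpoly0.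
rewrite /shift_poly !comp_mpolyD !comp_mpolyZ -/(shift_poly p) IH.
congr (_ *: _ + _); rewrite comp_mpolyX rmorph_prod /= [RHS]mpolyXE_id.
apply: eq_bigr => i _; rewrite rmorphXn /=; congr (_ ^+ _).
case: i => [[|[|//]] i2]; rewrite (tnth_nth 0) /=.
  rewrite comp_mpolyD comp_mpoly1 comp_mpolyXU /= subrK.
  by congr 'X__; apply: val_inj.
by rewrite comp_mpolyXU /=; congr 'X__; apply: val_inj.
Qed.

Fact shift_poly_eq0 p : (shift_poly p == 0) = (p == 0).
Proof.
apply/eqP/eqP => [p0|->]; last exact: comp_mpoly0.
by rewrite -(shift_polyK p) p0 comp_mpoly0.
Qed.

Fact fracE (x : Qqt) : x = tofrac (\n_(repr x)) / tofrac (\d_(repr x)).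
Proof.
have d0 : tofrac (\d_(repr x)) != 0 by rewrite tofrac_eq0 denom_ratioP.
apply: (mulIf d0); rewrite divfK // -{1}[x]reprK; set r := repr x.
unlock tofrac; rewrite -[LHS]FracField.pi_mul; apply/eqmodP/eqP => /=.
by rewrite /FracField.mulf !numden_Ratio ?mulr1 ?denom_ratioP ?oner_eq0 // mulrC.
Qed.

Fact shift_fracE n d : d != 0 ->
  shift_frac (tofrac n / tofrac d) = tofrac (shift_poly n) / tofrac (shift_poly d).
Proof.
move=> d0; rewrite /shift_frac; set x := (tofrac n / tofrac d : Qqt).
have := fracE x; rewrite {1}/x => /eqP.
have d0' := denom_ratioP (repr x).
rewrite eqr_div ?tofrac_eq0 // -!tofracM tofrac_eq => /eqP e.
apply/eqP; rewrite eqr_div ?tofrac_eq0 ?shift_poly_eq0 //.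
by rewrite -!tofracM tofrac_eq /shift_poly -!rmorphM e.
Qed.

Fact shift_frac_tofrac p : shift_frac (tofrac p) = tofrac (shift_poly p).
Proof.
have := @shift_fracE p 1 (oner_neq0 _).
by rewrite /shift_poly comp_mpoly1 !tofrac1 !divr1.
Qed.

Fact shift_frac_zmod : zmod_morphism shift_frac.
Proof.
move=> x y; rewrite [x]fracE [y]fracE; move: (repr x) (repr y) => r s.
have [dr ds] := (denom_ratioP r, denom_ratioP s).
have frac_sub (a b c d : {mpoly rat[2]}) : b != 0 -> d != 0 ->
    tofrac a / tofrac b - tofrac c / tofrac d
      = tofrac (a * d - c * b) / tofrac (b * d) :> Qqt.
  move=> b0 d0; rewrite -mulNr addf_div ?tofrac_eq0 //.
  by rewrite tofracB !tofracM mulNr.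
rewrite frac_sub // !shift_fracE ?mulf_neq0 // frac_sub ?shift_poly_eq0 //.
by rewrite /shift_poly rmorphB !rmorphM.
Qed.

Fact shift_frac_monoid : monoid_morphism shift_frac.
Proof.
split=> [|x y]; first by rewrite -tofrac1 shift_frac_tofrac /shift_poly comp_mpoly1.
rewrite [x]fracE [y]fracE; move: (repr x) (repr y) => r s.
have [dr ds] := (denom_ratioP r, denom_ratioP s).
rewrite mulf_div -!tofracM !shift_fracE ?mulf_neq0 // mulf_div.
by rewrite -!tofracM /shift_poly !rmorphM.
Qed.

HB.instance Definition _ :=
  GRing.isZmodMorphism.Build Qqt Qqt shift_frac shift_frac_zmod.
HB.instance Definition _ :=
  GRing.isMonoidMorphism.Build Qqt Qqt shift_frac shift_frac_monoid.

Section SubstCoef.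
Variables (R S : comNzRingType) (h : {rmorphism R -> S}).

Fact last0_map n (p : {mpoly R[n.+1]}) :
  last0 (map_mpoly h p) = map_mpoly h (last0 p).
Proof.
elim/mpolyind: p => [|c m p _ _ IH]; first by rewrite /last0 !raddf0 !horner0 raddf0.
rewrite raddfD /= map_mpolyZ map_mpolyX !last0D !last0Z IH raddfD /= map_mpolyZ.
congr (_ *: _ + _); rewrite /last0 !muniE !msuppX !big_seq1 !mcoeffX !eqxx.
rewrite !scale1r !hornerZ !hornerXn !expr0n.
by case: eqP => _; rewrite ?mulr1 ?map_mpolyX // !mulr0 raddf0.
Qed.

Lemma is_symfun_map (f : symfun R) : is_symfun (fun n => map_mpoly h (f n)).
Proof.
case: f => [f [fS fT [d fd]]]; split=> [n|n|] /=.
- apply/issymP => s; apply/mpolyP => m.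
  by rewrite mcoeff_sym !mcoeff_map_mpoly /= msym_coeff.
- by rewrite last0_map fT.
exists d => n; apply: leq_trans (fd n); rewrite [X in (X <= _)%N]msizeE.
apply/bigmax_leqP_seq => m mf _; apply: msize_mdeg_lt.
apply: contraLR mf; rewrite !mcoeff_msupp !negbK mcoeff_map_mpoly.
by move/eqP => fm0; rewrite /= fm0 rmorph0.
Qed.

Definition symfun_map (f : symfun R) : symfun S := SymFun (is_symfun_map f).

End SubstCoef.

Definition Lambda := symfun Qqt.
HB.instance Definition _ := GRing.ComNzRing.on Lambda.
HB.instance Definition _ := GRing.Lmodule.on Lambda.
HB.instance Definition _ := GRing.Lalgebra.on Lambda.

Definition e_ (r : nat) : Lambda := elem Qqt r.

Definition p_S (r : nat) : Lambda := psum Qqt r.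

Definition shift_q (f : Lambda) : Lambda := symfun_map shift_frac f.

Definition is_partition (mu : seq nat) : bool :=
  sorted geq mu && (0%N \notin mu).

Definition e_part (mu : seq nat) : Lambda := \prod_(r <- mu) e_ r.

Definition e_positive (f : Lambda) : Prop :=
  exists (s : seq (seq nat)) (c : seq nat -> Qqt),
    [/\ uniq s, all is_partition s, forall mu, mu \in s -> Nqt (c mu) &
        f = \sum_(mu <- s) c mu *: e_part mu].

(* y_i is 'X_(i-1): the variables of mpoly are indexed from 0. *)
Definition V_ (k : nat) := {mpoly Lambda[k]}.
HB.instance Definition _ k := GRing.ComNzRing.on (V_ k).

Definition scal k (c : Qqt) : V_ k := (c%:A : Lambda)%:MP.

(* f[X + eps (q - 1) y] for f in Lambda: write f as a polynomial P in the power
   sums p_1, ..., p_N, which are algebraically independent generators of Lambda,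
   and replace each p_r by p_r + eps (q^r - 1) y^r. *)
Definition plethL k (eps : Qqt) (y : V_ k) (f : Lambda) : V_ k :=
  xget 0 [set g | exists (N : nat) (P : {mpoly Qqt[N]}),
    f = mmap (fun c => c%:A) (fun r => p_S r) P /\
    g = mmap (@scal k)
          (fun r => (p_S r)%:MP + scal k (eps * (q ^+ r.+1 - 1)) * y ^+ r.+1) P].

Definition pleth k (eps : Qqt) (y : V_ k) (F : V_ k) : V_ k :=
  mmap (plethL eps y) (fun i => 'X_i) F.

(* The exact quotient, for a regular D dividing F. *)
Definition quotV k (F D : V_ k) : V_ k := xget 0 [set G | D * G = F].

(* For i < k, this is T_(i+1), acting on V_(k+1). *)
Definition T_ k (i : 'I_k) (F : V_ k.+1) : V_ k.+1 :=
  let a := widen_ord (leqnSn k) i in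
  let b := lift ord0 i in
  quotV (scal k.+1 (q - 1) * 'X_a * F
           + ('X_b - scal k.+1 q * 'X_a) * msym (tperm a b) F)
        ('X_b - 'X_a).

Definition d_plus k (F : V_ k) : V_ k.+1 :=
  foldr (@T_ k) (pleth 1 'X_ord_max (mwiden F)) (enum 'I_k).

(* For G in V_(k+1), (muni G)`_j in V_k is the coefficient of y_(k+1)^j. The
   coefficient of y^-1 in G * sum_i (- 1 / y)^i e_i collects the terms with
   i = j + 1. *)
Definition d_minus k (F : V_ k.+1) : V_ k :=
  let G := pleth (- 1) 'X_ord_max F in
  - \sum_(j < size (muni G)) (-1) ^+ j.+1 * (e_ j.+1)%:MP * (muni G)`_j.

Definition phi k (F : V_ k.+1) : V_ k.+1 :=
  scal k.+1 (q - 1)^-1 * (d_minus (d_plus F) - d_plus (d_minus F)).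

Variant step := North | Diag | East.

Definition move_step (s : step) (a : nat * nat) : nat * nat :=
  match s with
  | North => (a.1, a.2.+1)
  | Diag => (a.1.+1, a.2.+1)
  | East => (a.1.+1, a.2)
  end.

Definition is_diag (s : step) : bool := if s is Diag then true else false.

(* The steps P lead from a to the line y = x, staying weakly above it and
   without a diagonal step along it. *)
Fixpoint path_from (a : nat * nat) (P : seq step) : bool :=
  match P with
  | [::] => a.1 == a.2
  | s :: P' => [&& (a.1 <= a.2)%N, ~~ (is_diag s && (a.1 == a.2))
                 & path_from (move_step s a) P']
  end.

Definition in_P (P : seq step) : bool := path_from (0, 0)%N P.

(* North, diagonal and east steps stand for the letters -, 0, + and hence for
   d_-, phi, d_+, which map V_k to V_(step_deg s k). On V_0, d_- and phi do not
   exist and are replaced by 0: the words of paths in in_P never apply them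
   there. *)
Definition step_deg (s : step) (k : nat) : nat :=
  match s with North => k.-1 | Diag => k | East => k.+1 end.

Definition step_op (s : step) (k : nat) : V_ k -> V_ (step_deg s k) :=
  match s with
  | North => match k with 0 => fun=> 0 | k'.+1 => @d_minus k' end
  | Diag => match k with 0 => fun=> 0 | k'.+1 => @phi k' end
  | East => @d_plus k
  end.

Fixpoint path_deg (P : seq step) (k : nat) : nat :=
  if P is s :: P' then step_deg s (path_deg P' k) else k.

Fixpoint word_op (P : seq step) (k : nat) : V_ k -> V_ (path_deg P k) :=
  match P with
  | [::] => id
  | s :: P' => fun F => @step_op s _ (@word_op P' k F)
  end.

(* V_0 is identified with Lambda by the constant coefficient; path_deg P 0 is 0
   for P in in_P. *)
Definition d_path (P : seq step) (f : Lambda) : Lambda :=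
  (@word_op P 0 (f%:MP : V_ 0))@_0.

(* Main.v *)
From HB Require Import structures.
Require Import Defs.
From mathcomp Require Import all_boot all_algebra.
From mathcomp Require Import perm boolp classical_sets mpoly ring zify.

Set Implicit Arguments.
Unset Strict Implicit.
Unset Printing Implicit Defensive.

Import GRing.Theory.

Local Open Scope ring_scope.

(* The twist y_i |-> - x_i, X |-> X - (q - 1)(y_1 + ... + y_k) of V_k makes all
   the operators linear over Lambda. It turns d_+ into F |-> T_1 ... T_k F, phi
   into F |-> T_1 ... T_(k-1) (x_k F), and d_- into the Lambda[x_1, ..., x_(k-1)]-
   linear map sending x_k^j to w_(j+1), where w_n is the coefficient of z^-n in
   the product of sum_r e_r z^-r and of all the (1 - x_i / z) / (1 - q x_i / z)
   with i < k. For q = s + 1 this kernel factor is 1 + s sum_(i>0) q^(i-1) (x/z)^i,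
   which is positive, but the T_i are not. However, let
   D_j,a g = T_j ... T_k (x_(k+1)^a g) for g in V_k. The cone spanned in V_(k+1)
   by the D_j,a g with g in the cone of V_k, starting from the e-positive
   functions in V_0, is preserved by d_+ = D_1,0, by phi and by d_-: in every
   commutation with D_j,a the terms with the sign of - s coming from
   T_i^2 = q - s T_i cancel. *)

(** * Hecke operators *)

(** The sign in the twist is chosen for d_-: it absorbs the factors (-1/y_k)^i, and it does not
    affect the T_i, which are homogeneous of degree 0. The summand of the twist belonging to the
    last variable cancels the substitution in d_+ and reproduces the one in d_-. The form of phi is
    then read off from the commutator of d_- with D_1,0, which carries an explicit factor q - 1. For
    general D_j,a this commutator contains T_j ... T_(k-1) (x_k^i F) for all i from 1 to a + 1, so
    stability of the cone has to be proved for this whole family, of which phi is one member. The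
    restriction i > 0 is essential to the argument: the term that cancels the negative part of T^2
    is the top term produced by moving x_k^i past a T, and for i = 0 there is none. Since the
    substitutions are specified through a chosen polynomial in the power sums, they must first be
    shown to be ring homomorphisms. For this Lambda is proved free on the e_r, from the fundamental
    theorem in finitely many variables, and Newton's identities carry freeness over to the power
    sums; they also give the recursion in k for the w_n. *)

Lemma eq_of_subr (V : zmodType) (a b x y : V) : x = y -> a - b = x - y -> a = b.
Proof. by move=> -> /eqP; rewrite subrr subr_eq0 => /eqP. Qed.

(* Fa, Fab, ... stand for the images of F under the products of the transpositions
   (a b), labelled a, and (b c), labelled b; Fw for that under the longest one. *)
Lemma braid_identity (K : comNzRingType)
    (q a b c F Fa Fb Fab Fba Fw G Ga Gb Gab H Ha Hb Hba U Ua W Wb P Q : K) :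
  GRing.lreg (b - a) -> GRing.lreg (c - b) -> GRing.lreg (c - a) ->
  (b - a) * G = (q - 1) * a * F + (b - q * a) * Fa ->
  (c - b) * H = (q - 1) * b * F + (c - q * b) * Fb ->
  (c - b) * U = (q - 1) * b * G + (c - q * b) * Gb ->
  (b - a) * W = (q - 1) * a * H + (b - q * a) * Ha ->
  (b - a) * P = (q - 1) * a * U + (b - q * a) * Ua ->
  (c - b) * Q = (q - 1) * b * W + (c - q * b) * Wb ->
  (a - b) * Ga = (q - 1) * b * Fa + (a - q * b) * F ->
  (b - c) * Hb = (q - 1) * c * Fb + (b - q * c) * F ->
  (c - a) * Gb = (q - 1) * a * Fb + (c - q * a) * Fba ->
  (c - a) * Ha = (q - 1) * a * Fa + (c - q * a) * Fab ->
  (c - b) * Gab = (q - 1) * b * Fab + (c - q * b) * Fw ->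
  (b - a) * Hba = (q - 1) * a * Fba + (b - q * a) * Fw ->
  (c - a) * Ua = (q - 1) * a * Ga + (c - q * a) * Gab ->
  (c - a) * Wb = (q - 1) * a * Hb + (c - q * a) * Hba ->
  P = Q.
Proof.
move=> r1 r2 r3 eG eH eU eW eP eQ eGa eHb eGb eHa eGab eHba eUa eWb.
(* Multiplying the goal by the square of all three denominators makes it a linear combination of the
   hypotheses. The coefficients come from expanding [P] and [Q] from the outermost operator inwards;
   [eq_of_subr] leaves a polynomial identity. *)
do 2![apply: (r1); apply: (r2); apply: (r3)].
pose D1 := b - a; pose D2 := c - b; pose D3 := c - a; pose M := D1 * D2 * D3.
pose sa := (q - 1) * a; pose sb := (q - 1) * b.
pose Bab := b - q * a; pose Bbc := c - q * b; pose Bac := c - q * a.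
apply: (eq_of_subr (congr2 +%R
  (congr2 +%R (congr2 +%R (congr2 +%R
    (congr1 ( *%R (M * D2 * D3)) eP) (congr1 ( *%R (M * D3 * sa)) eU))
   (congr2 +%R
    (congr1 ( *%R (M * D2 * Bab)) eUa) (congr1 ( *%R (D2 * D3 * D3 * sa * sb)) eG)))
   (congr2 +%R (congr2 +%R
    (congr1 ( *%R (D1 * D2 * D3 * sa * Bbc)) eGb)
    (congr1 ( *%R (- (D2 * D3 * D2 * Bab * sa))) eGa))
    (congr1 ( *%R (D1 * D3 * D2 * Bab * Bac)) eGab)))
  (congr2 +%R (congr2 +%R (congr2 +%R
    (congr1 ( *%R (- (M * D1 * D3))) eQ) (congr1 ( *%R (- (M * D3 * sb))) eW))
   (congr2 +%R
    (congr1 ( *%R (- (M * D1 * Bbc))) eWb)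
    (congr1 ( *%R (- (D1 * D3 * D3 * sb * sa))) eH)))
   (congr2 +%R (congr2 +%R
    (congr1 ( *%R (- (D1 * D2 * D3 * sb * Bab))) eHa)
    (congr1 ( *%R (D1 * D3 * D1 * Bbc * sa)) eHb))
    (congr1 ( *%R (- (D2 * D3 * D1 * Bbc * Bac))) eHba))))).
by rewrite /M /D1 /D2 /D3 /sa /sb /Bab /Bbc /Bac; ring.
Qed.

(* hecke, heckeS, pleth_rm and twist are sealed: ring and rewrite compare terms
   up to conversion, which must not unfold them. *)
Fact hecke_sealed : {T : forall (R : comNzRingType) (q : R) n (a b : 'I_n),
    {mpoly R[n]} -> {mpoly R[n]} |
  forall R q n a b F, T R q n a b F
    = xget 0 [set G | ('X_b - 'X_a) * G
        = (q%:MP - 1) * 'X_a * F + ('X_b - q%:MP * 'X_a) * msym (tperm a b) F]%classic}.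
Proof. by eexists. Qed.

Definition hecke (R : comNzRingType) (q : R) n (a b : 'I_n) :
  {mpoly R[n]} -> {mpoly R[n]} := @sval _ _ hecke_sealed R q n a b.

(* Generalizing the atoms spares ring their comparison up to conversion. *)
Ltac mring :=
  repeat match goal with |- context [hecke ?q ?a ?b ?F] => generalize (hecke q a b F) end;
  repeat match goal with |- context [msym ?s ?F] => generalize (msym s F) end;
  repeat match goal with |- context [mwiden ?F] => generalize (mwiden F) end;
  repeat match goal with |- context [mpolyX ?R ?m] => generalize (mpolyX R m) end;
  repeat match goal with |- context [mpolyC ?n ?x] => generalize (mpolyC n x) end;
  intros; ring.

Section Hecke.
Variables (R : comNzRingType) (q : R) (n : nat).
Implicit Types (a b c : 'I_n) (F G H : {mpoly R[n]}).

Local Notation qC := (q%:MP_[n]).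
Local Notation hecke := (hecke q).
Local Notation sw a b := (msym (tperm a b)).

(** The leading coefficient is 1 or -1, so division is unique over any coefficient ring; the one of
    interest is [Lambda], known here only as a commutative ring. *)
Lemma lreg_subX a b : a != b -> GRing.lreg ('X_b - 'X_a : {mpoly R[n]}).
Proof.
move=> ab; set D := _ - _.
have DE m : D@_m = (U_(b)%MM == m)%:R - (U_(a)%MM == m)%:R.
  by rewrite mcoeffB !mcoeffX.
have nab : (U_(b)%MM == U_(a)%MM :> 'X_{1..n}) = false.
  by apply/eqP => /mnmP /(_ a); rewrite !mnm1E eqxx eq_sym (negbTE ab).
have D0 : D != 0.
  apply/eqP => /mpolyP /(_ U_(b)%MM); rewrite DE eqxx.
  rewrite [U_(a)%MM == _]eq_sym nab mcoeff0 subr0.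
  by move/eqP; rewrite oner_eq0.
apply: lreg_mleadc; have: D@_(mlead D) != 0 by rewrite mleadc_eq0.
rewrite DE; have [<-|_] := eqVneq U_(b)%MM (mlead D).
  by rewrite [U_(a)%MM == _]eq_sym nab subr0 => _; apply: lreg1.
rewrite sub0r; case: (_ == mlead D); last by rewrite oppr0 eqxx.
by move=> _; apply: lregN; apply: lreg1.
Qed.

Lemma msymXi (s : 'S_n) a : msym s 'X_a = 'X_(s a) :> {mpoly R[n]}.
Proof. by rewrite /msym mmapX mmap1U. Qed.

Lemma msymC (s : 'S_n) (x : R) : msym s x%:MP = x%:MP.
Proof. by rewrite /msym mmapC. Qed.

(** Divisibility passes to products by F1 F2 - s(F1 F2) = (F1 - s F1) F2 + s F1 (F2 - s F2), which
    reduces it to the variables. *)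
Lemma subX_dvd a b F : exists G, F - sw a b F = ('X_b - 'X_a) * G.
Proof.
have PM F1 F2 : (exists G, F1 - sw a b F1 = ('X_b - 'X_a) * G) ->
    (exists G, F2 - sw a b F2 = ('X_b - 'X_a) * G) ->
    exists G, F1 * F2 - sw a b (F1 * F2) = ('X_b - 'X_a) * G.
  move=> [G1 e1] [G2 e2]; exists (G1 * F2 + sw a b F1 * G2).
  by rewrite mulrDr mulrA -e1 mulrCA -e2 msymM; mring.
have P1 : exists G, 1 - sw a b 1 = ('X_b - 'X_a) * G.
  by exists 0; rewrite msym1 subrr mulr0.
elim/mpolyind: F => [|x m p _ _ [G e]].
  by exists 0; rewrite msym0 subrr mulr0.
suff [G' e'] : exists G, 'X_[m] - sw a b 'X_[m] = ('X_b - 'X_a) * G.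
  exists (x *: G' + G); rewrite msymD msymZ opprD addrACA e -scalerBr e'.
  by rewrite mulrDr scalerAr.
rewrite mpolyXE_id; pose div F := exists G, F - sw a b F = ('X_b - 'X_a) * G.
apply: (big_ind div) => [||i _]; [exact: P1|exact: PM|].
elim: (m i) => [|k IH]; first by rewrite expr0.
rewrite exprS; apply: (PM 'X_i ('X_i ^+ k) _ IH).
rewrite msymXi.
case: tpermP => [->|->|_ _]; first by exists (-1); mring.
  by exists 1; mring.
by exists 0; mring.
Qed.

Lemma heckeE a b F :
  ('X_b - 'X_a) * hecke a b F
  = (qC - 1) * 'X_a * F + ('X_b - qC * 'X_a) * sw a b F.
Proof.
rewrite /hecke (svalP hecke_sealed); case: xgetP => [G _ //|no].
have [G e] := subX_dvd a b F.
(* The solution is s F + (q - 1) x_a [G], with [G] the negative of the usual divided difference (F -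
   s F) / (x_a - x_b); hence the default value of [xget] never occurs. *)
exfalso; apply: (no (sw a b F + (qC - 1) * 'X_a * G)) => /=.
have -> : F = sw a b F + ('X_b - 'X_a) * G by rewrite -e subrKC.
by rewrite -e subrKC; move: (sw a b F) e => H /eqP; rewrite subr_eq => /eqP ->; mring.
Qed.

Lemma heckeP a b F G : a != b ->
  ('X_b - 'X_a) * G = (qC - 1) * 'X_a * F + ('X_b - qC * 'X_a) * sw a b F ->
  hecke a b F = G.
Proof. by move=> ab e; apply: (lreg_subX ab); rewrite heckeE e. Qed.

Lemma heckeD a b F G : a != b -> hecke a b (F + G) = hecke a b F + hecke a b G.
Proof.
move=> ab; apply: heckeP => //; rewrite msymD.
by apply: (eq_of_subr (congr2 +%R (heckeE a b F) (heckeE a b G))); mring.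
Qed.

Lemma heckeMl a b H F : a != b -> sw a b H = H ->
  hecke a b (H * F) = H * hecke a b F.
Proof.
move=> ab e; apply: heckeP => //; rewrite msymM e.
apply: (eq_of_subr (congr1 ( *%R H) (heckeE a b F))); mring.
Qed.

Lemma sw_heckeE (s : 'S_n) a b F :
  ('X_(s b) - 'X_(s a)) * msym s (hecke a b F)
  = (qC - 1) * 'X_(s a) * msym s F
    + ('X_(s b) - qC * 'X_(s a)) * msym s (sw a b F).
Proof.
have := congr1 (msym s) (heckeE a b F).
by rewrite !(msymM, msymD, msymN, msym1, msymC, msymXi).
Qed.

(** This is (T - 1)(T + q) = 0. Swapping the variables in the equation that defines T F expresses
    the swap of T F through F and its swap, and the latter is eliminated by the equation itself. *)
Lemma hecke_quad a b F : a != b ->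
  hecke a b (hecke a b F) = qC * F - (qC - 1) * hecke a b F.
Proof.
move=> ab; apply: heckeP => //; apply: (lreg_subX ab).
have e := heckeE a b F; have := sw_heckeE (tperm a b) a b F.
rewrite tpermL tpermR -msymMm tperm2 msym1m => e'.
pose D : {mpoly R[n]} := 'X_b - 'X_a.
apply: (eq_of_subr (congr2 +%R
  (congr1 ( *%R (- (D * (qC - 1) + (qC - 1) * 'X_a))) e)
  (congr1 ( *%R ('X_b - qC * 'X_a)) e'))).
rewrite /D; mring.
Qed.

Lemma hecke_comm a b c (d : 'I_n) F : uniq [:: a; b; c; d] ->
  hecke a b (hecke c d F) = hecke c d (hecke a b F).
Proof.
rewrite /= !inE !negb_or !andbT => /and3P[/and3P[ab ac ad] /andP[bc bd] cd].
have [ca cb da db] : [/\ c != a, c != b, d != a & d != b] by split; rewrite eq_sym.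
have e1 := heckeE a b F; have e2 := heckeE c d F.
have := sw_heckeE (tperm c d) a b F; have := sw_heckeE (tperm a b) c d F.
have -> : sw a b (sw c d F) = sw c d (sw a b F).
  rewrite -!msymMm; congr msym.
  suff /commgP : [~ tperm c d, tperm a b]%g == 1%g by [].
  by apply/conjg_fixP; rewrite tpermJ !tpermD.
rewrite (tpermD ca da) (tpermD cb db) (tpermD ac bc) (tpermD ad bd) => e2' e1'.
have e3 := heckeE a b (hecke c d F); have e4 := heckeE c d (hecke a b F).
apply: (lreg_subX ab); apply: (lreg_subX cd).
pose D1 : {mpoly R[n]} := 'X_b - 'X_a; pose D2 : {mpoly R[n]} := 'X_d - 'X_c.
apply: (eq_of_subr (congr2 +%R
  (congr2 +%R (congr1 ( *%R D2) e3) (congr1 ( *%R (- D1)) e4))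
  (congr2 +%R
    (congr2 +%R (congr1 ( *%R ((qC - 1) * 'X_a)) e2)
       (congr1 ( *%R ('X_b - qC * 'X_a)) e2'))
    (congr2 +%R (congr1 ( *%R (- ((qC - 1) * 'X_c))) e1)
       (congr1 ( *%R (- ('X_d - qC * 'X_c))) e1'))))).
rewrite /D1 /D2; mring.
Qed.

Lemma hecke_braid a b c F : uniq [:: a; b; c] ->
  hecke a b (hecke b c (hecke a b F)) = hecke b c (hecke a b (hecke b c F)).
Proof.
rewrite /= !inE !negb_or !andbT => /andP[/andP[ab ac] bc].
have [ba ca cb] : [/\ b != a, c != a & c != b] by split; rewrite eq_sym.
(* The two words for the longest permutation agree, so both sides are combinations of the same six
   images of [F]. *)
have swE : sw a b (sw b c (sw a b F)) = sw b c (sw a b (sw b c F)).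
  rewrite -!msymMm; congr msym.
  have J x y (s : 'S_n) : (tperm x y * (s * tperm x y) = s ^ tperm x y)%g.
    by rewrite conjgE tpermV.
  by rewrite !J !tpermJ tpermR tpermL !tpermD.
pose G := hecke a b F; pose H := hecke b c F.
have sw2 x y F' : sw x y (sw x y F') = F' by rewrite -msymMm tperm2 msym1m.
have := sw_heckeE (tperm a b) a b F; rewrite tpermL tpermR sw2 => e1s.
have := sw_heckeE (tperm b c) b c F; rewrite tpermL tpermR sw2 => e2s.
have := sw_heckeE (tperm b c) a b F; rewrite tpermL (tpermD ba ca) => e1t.
have := sw_heckeE (tperm a b) b c F; rewrite tpermR (tpermD ac bc) => e2t.
have := sw_heckeE (tperm b c * tperm a b) a b F.
rewrite !permM tpermL (tpermD ba ca) tpermL (tpermD ac bc) !msymMm swE => e1u.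
have := sw_heckeE (tperm a b * tperm b c) b c F.
rewrite !permM tpermR (tpermD ac bc) tpermR (tpermD ba ca) !msymMm => e2u.
have := sw_heckeE (tperm a b) b c G; rewrite tpermR (tpermD ac bc) => e3s.
have := sw_heckeE (tperm b c) a b H; rewrite tpermL (tpermD ba ca) => e4s.
exact: (braid_identity (lreg_subX ab) (lreg_subX bc) (lreg_subX ac)
  (heckeE a b F) (heckeE b c F) (heckeE b c G) (heckeE a b H)
  (heckeE a b (hecke b c G)) (heckeE b c (hecke a b H))
  e1s e2s e1t e2t e1u e2u e3s e4s).
Qed.

End Hecke.

Lemma mpoly_rmorph_ext (R : nzRingType) (S : nzRingType) n
    (f g : {rmorphism {mpoly R[n]} -> S}) :
  (forall c, f c%:MP = g c%:MP) -> (forall i, f 'X_i = g 'X_i) -> f =1 g.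
Proof.
move=> fgC fgX; elim/mpolyind => [|c m p _ _ IH]; first by rewrite !rmorph0.
rewrite !rmorphD /= IH -mul_mpolyC !rmorphM fgC; congr (_ * _ + _).
rewrite mpolyXE_id !rmorph_prod; apply: eq_bigr => i _.
by rewrite !rmorphXn fgX.
Qed.

Section HeckeWiden.
Variables (R : comNzRingType) (q : R) (n : nat).
Implicit Types (a b c : 'I_n) (F G H : {mpoly R[n]}).

Local Notation widen := (widen_ord (leqnSn n)).

Lemma widen_neq a b : (widen a != widen b) = (a != b).
Proof. by []. Qed.

Lemma mwiden_Xi a : mwiden 'X_a = 'X_(widen a) :> {mpoly R[n.+1]}.
Proof. by rewrite mwidenX mnmwiden1. Qed.

Lemma mwiden_sw a b F :
  mwiden (msym (tperm a b) F) = msym (tperm (widen a) (widen b)) (mwiden F).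
Proof.
pose f : {rmorphism _ -> {mpoly R[n.+1]}} := @mwiden n R \o msym (tperm a b).
pose g : {rmorphism _ -> {mpoly R[n.+1]}} :=
  msym (tperm (widen a) (widen b)) \o @mwiden n R.
apply: (mpoly_rmorph_ext (f := f) (g := g)) => [c|i] /=.
  by rewrite msymC !mwidenC msymC.
rewrite msymXi !mwiden_Xi msymXi; congr 'X_(_).
case: tpermP => [->|->|/eqP ia /eqP ib]; rewrite ?tpermL ?tpermR //.
by rewrite tpermD // widen_neq eq_sym.
Qed.

Lemma mwiden_hecke a b F : a != b ->
  mwiden (hecke q a b F) = hecke q (widen a) (widen b) (mwiden F).
Proof.
move=> ab; apply/esym/heckeP; first by rewrite widen_neq.
rewrite -mwiden_sw -!mwiden_Xi -(mwidenC n q) -mwiden1.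
by rewrite -!(mwidenB, mwidenM, mwidenD) heckeE.
Qed.

Lemma hecke_X a b F : a != b ->
  'X_b * hecke q a b F = hecke q a b ('X_a * F) + (q%:MP - 1) * 'X_a * F.
Proof.
move=> ab; apply: (lreg_subX ab); rewrite mulrDr heckeE msymM msymXi tpermL.
apply: (eq_of_subr (congr1 ( *%R 'X_b) (heckeE q a b F))); mring.
Qed.

(** Iterates the Bernstein-type relation [hecke_X]: moving powers of x_b inwards past T only costs
    terms with the sign of + (q - 1). *)
Lemma hecke_Xn a b F m : a != b ->
  'X_b ^+ m * hecke q a b F = hecke q a b ('X_a ^+ m * F)
    + (q%:MP - 1) * \sum_(l < m) 'X_a ^+ l.+1 * 'X_b ^+ (m - l.+1) * F.
Proof.
move=> ab; elim: m => [|m IH]; first by rewrite big_ord0 mulr0 addr0 !mul1r.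
rewrite exprS -mulrA IH mulrDr (hecke_X _ ab) mulrA -exprS.
rewrite big_ord_recr /= subnn expr0 mulr1.
have -> : \sum_(l < m) 'X_a ^+ l.+1 * 'X_b ^+ (m.+1 - l.+1) * F
    = 'X_b * \sum_(l < m) 'X_a ^+ l.+1 * 'X_b ^+ (m - l.+1) * F.
  rewrite mulr_sumr; apply: eq_bigr => l _.
  by rewrite subSn // [X in _ * X * _]exprS -!mulrA mulrCA.
move: (\sum_(l < m) _) (hecke _ _ _ _) => S1 H; rewrite exprS; mring.
Qed.

End HeckeWiden.

(** * Hecke operators and variables indexed by natural numbers *)

Section NatIndex.
Variables (R : comNzRingType) (q : R).

Definition xvar k (i : nat) : {mpoly R[k]} :=
  if insub i is Some j then 'X_j else 0.

Fact heckeS_sealed : {T : forall k, nat -> {mpoly R[k]} -> {mpoly R[k]} |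
  forall k i (F : {mpoly R[k]}), T k i F = match insub i, insub i.+1 with
    | Some a, Some b => hecke q a b F
    | _, _ => F
    end}.
Proof. by eexists. Qed.

(* T_(i+1) on polynomials in k variables, and the identity unless i.+1 < k. *)
Definition heckeS k : nat -> {mpoly R[k]} -> {mpoly R[k]} := sval heckeS_sealed k.

Lemma xvarE k (j : 'I_k) : xvar k j = 'X_j.
Proof. by rewrite /xvar valK. Qed.

Lemma xvar_ord k i (h : (i < k)%N) : xvar k i = 'X_(Ordinal h).
Proof. by rewrite -xvarE. Qed.

Lemma xvar_widen k i : (i < k)%N -> mwiden (xvar k i) = xvar k.+1 i.
Proof. by move=> h; rewrite xvar_ord mwiden_Xi -xvarE. Qed.

Lemma heckeS_ord k i (h' : (i < k)%N) (h : (i.+1 < k)%N) F :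
  heckeS i F = hecke q (Ordinal h') (Ordinal h) F.
Proof. by rewrite /heckeS (svalP heckeS_sealed) !insubT. Qed.

Lemma heckeSD k i (F G : {mpoly R[k]}) : (i.+1 < k)%N ->
  heckeS i (F + G) = heckeS i F + heckeS i G.
Proof.
move=> h; rewrite !(heckeS_ord (ltnW h) h) heckeD //.
by rewrite -val_eqE /= ltn_eqF.
Qed.

Lemma heckeS_Ml k i (H F : {mpoly R[k]}) : (i.+1 < k)%N ->
  (forall a b : 'I_k, a = i :> nat -> b = i.+1 :> nat -> msym (tperm a b) H = H) ->
  heckeS i (H * F) = H * heckeS i F.
Proof.
move=> h e; rewrite !(heckeS_ord (ltnW h) h) heckeMl //; last exact: e.
by rewrite -val_eqE /= ltn_eqF.
Qed.

Lemma heckeS_C k i c (F : {mpoly R[k]}) : (i.+1 < k)%N ->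
  heckeS i (c%:MP * F) = c%:MP * heckeS i F.
Proof. by move=> h; apply: heckeS_Ml => // a b _ _; rewrite msymC. Qed.

Lemma heckeS_Xn k i j m (F : {mpoly R[k]}) : (i.+1 < k)%N -> j != i -> j != i.+1 ->
  heckeS i (xvar k j ^+ m * F) = xvar k j ^+ m * heckeS i F.
Proof.
move=> h ji ji1; apply: heckeS_Ml => // a b ea eb.
rewrite rmorphXn /=; congr (_ ^+ _).
rewrite /xvar; case: insubP => [c _ ec|_]; last exact: msym0.
by rewrite msymXi tpermD // -val_eqE /= ?ea ?eb ec eq_sym.
Qed.

Lemma heckeS_quad k i (F : {mpoly R[k]}) : (i.+1 < k)%N ->
  heckeS i (heckeS i F) = q%:MP * F - (q%:MP - 1) * heckeS i F.
Proof.
move=> h; rewrite !(heckeS_ord (ltnW h) h) hecke_quad //.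
by rewrite -val_eqE /= ltn_eqF.
Qed.

Lemma heckeS_braid k i (F : {mpoly R[k]}) : (i.+2 < k)%N ->
  heckeS i (heckeS i.+1 (heckeS i F)) = heckeS i.+1 (heckeS i (heckeS i.+1 F)).
Proof.
move=> h; have h1 := ltnW h; rewrite !(heckeS_ord (ltnW h1) h1) !(heckeS_ord h1 h).
by rewrite hecke_braid //= !inE -!val_eqE /= !ltn_eqF.
Qed.

Lemma heckeS_comm k i j (F : {mpoly R[k]}) : (i.+1 < j)%N -> (j.+1 < k)%N ->
  heckeS i (heckeS j F) = heckeS j (heckeS i F).
Proof.
move=> ij h; have h1 : (i.+1 < k)%N by rewrite (ltn_trans ij) // ltnW.
rewrite !(heckeS_ord (ltnW h1) h1) !(heckeS_ord (ltnW h) h) hecke_comm //=.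
rewrite !inE -!val_eqE /= !eqSS !negb_or !andbT.
have ij' := ltnW ij.
by rewrite !ltn_eqF // ltnW // ltnW.
Qed.

Lemma heckeS_XnS k i m (F : {mpoly R[k]}) : (i.+1 < k)%N ->
  xvar k i.+1 ^+ m * heckeS i F = heckeS i (xvar k i ^+ m * F)
    + (q%:MP - 1) * \sum_(l < m) xvar k i ^+ l.+1 * xvar k i.+1 ^+ (m - l.+1) * F.
Proof.
move=> h; rewrite !(heckeS_ord (ltnW h) h) (xvar_ord h) (xvar_ord (ltnW h)) hecke_Xn //.
by rewrite -val_eqE /= ltn_eqF.
Qed.

Lemma heckeS_widen k i (F : {mpoly R[k]}) : (i.+1 < k)%N ->
  mwiden (heckeS i F) = heckeS i (mwiden F).
Proof.
move=> h; rewrite (heckeS_ord (ltnW h) h) mwiden_hecke; last first.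
  by rewrite -val_eqE /= ltn_eqF.
rewrite (heckeS_ord (leqW (ltnW h)) (leqW h)); congr hecke; exact: val_inj.
Qed.

End NatIndex.

(** * Homomorphisms out of the symmetric functions *)

Section Evaluation.
Variables (K B : comNzRingType) (c : {rmorphism K -> B}) (x : nat -> B).

(** The point [x] is an infinite sequence, so that polynomials in different numbers of variables are
    evaluated at the same point and can be compared after padding. *)
Definition peval N (P : {mpoly K[N]}) : B := mmap c (fun i : 'I_N => x i) P.

HB.instance Definition _ N :=
  GRing.RMorphism.copy (@peval N) (mmap c (fun i : 'I_N => x i)).

Lemma peval_C N a : peval (a%:MP_[N]) = c a.
Proof. exact: mmapC. Qed.

Lemma peval_X N (i : 'I_N) : peval 'X_i = x i.
Proof. by rewrite /peval mmapX mmap1U. Qed.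

Lemma peval_widen N (P : {mpoly K[N]}) : peval (mwiden P) = peval P.
Proof.
pose f : {rmorphism _ -> B} := @peval N.+1 \o @mwiden N K.
apply: (mpoly_rmorph_ext (f := f) (g := @peval N)) => [a|i] /=.
  by rewrite mwidenC !peval_C.
by rewrite mwiden_Xi !peval_X.
Qed.

End Evaluation.

Lemma peval_pad (K : comNzRingType) N M (P : {mpoly K[N]}) : (N <= M)%N ->
  exists Q : {mpoly K[M]}, forall (B : comNzRingType) (c : {rmorphism K -> B}) x,
    peval c x Q = peval c x P.
Proof.
elim: M => [|M IH].
  by rewrite leqn0 => /eqP e; move: P; rewrite e => P; exists P.
rewrite leq_eqVlt => /orP[/eqP e|/IH[Q e]].
  by clear IH; move: P; rewrite e => P; exists P.
by exists (mwiden Q) => B c x; rewrite peval_widen.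
Qed.

Lemma peval_rmorph (K B C : comNzRingType) (c : {rmorphism K -> B}) x
    (f : {rmorphism B -> C}) N (P : {mpoly K[N]}) :
  f (peval c x P) = peval (f \o c) (f \o x) P.
Proof.
pose g : {rmorphism _ -> C} := f \o @peval _ _ c x N.
pose h : {rmorphism K -> C} := f \o c.
suff e : g =1 @peval K C h (f \o x) N by exact: e.
by apply: mpoly_rmorph_ext => [a|i] /=; rewrite ?peval_C ?peval_X.
Qed.

Section Generation.
Variables (K B : comNzRingType) (c : {rmorphism K -> B}) (x : nat -> B).

Definition generated (f : B) := exists N (P : {mpoly K[N]}), f = peval c x P.

Lemma generatedC a : generated (c a).
Proof. by exists 0%N, a%:MP; rewrite peval_C. Qed.

Lemma generatedX i : generated (x i).
Proof. by exists i.+1, 'X_ord_max; rewrite peval_X. Qed.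

Lemma generated2 f g : generated f -> generated g ->
  exists N (P Q : {mpoly K[N]}), f = peval c x P /\ g = peval c x Q.
Proof.
move=> [N [P ->]] [M [Q ->]].
have [P' eP] := peval_pad P (leq_maxl N M); have [Q' eQ] := peval_pad Q (leq_maxr N M).
by exists (maxn N M), P', Q'; rewrite eP eQ.
Qed.

Lemma generatedD f g : generated f -> generated g -> generated (f + g).
Proof.
move=> gf gg; have [N [P [Q [-> ->]]]] := generated2 gf gg.
by exists N, (P + Q); rewrite rmorphD.
Qed.

Lemma generatedM f g : generated f -> generated g -> generated (f * g).
Proof.
move=> gf gg; have [N [P [Q [-> ->]]]] := generated2 gf gg.
by exists N, (P * Q); rewrite rmorphM.
Qed.

Lemma generated_sum n (F : 'I_n -> B) :
  (forall i, generated (F i)) -> generated (\sum_(i < n) F i).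
Proof.
move=> h; elim/big_ind: _ => // [|? ?]; last exact: generatedD.
by rewrite -(rmorph0 c); apply: generatedC.
Qed.

Lemma generated_peval (y : nat -> B) N (P : {mpoly K[N]}) :
  (forall i, generated (y i)) -> generated (peval c y P).
Proof.
move=> gy; elim/mpolyind: P => [|a m P _ _ IH].
  by rewrite rmorph0 -(rmorph0 c); apply: generatedC.
rewrite rmorphD -mul_mpolyC rmorphM /= peval_C; apply: generatedD => //.
apply: generatedM; first exact: generatedC.
rewrite mpolyXE_id rmorph_prod; apply: (big_ind generated) => [||i _].
- by rewrite -(rmorph1 c); apply: generatedC.
- exact: generatedM.
rewrite rmorphXn /= peval_X; elim: (m i) => [|n IHn].
  by rewrite expr0 -(rmorph1 c); apply: generatedC.
by rewrite exprS; apply: generatedM.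
Qed.

End Generation.

(** * The elementary symmetric functions as free generators *)

Section ElementaryGenerators.
Variable K : comNzRingType.
Local Notation Lam := (symfun K).

Definition restr n (f : Lam) : {mpoly K[n]} := f n.

Fact restr_zmod n : zmod_morphism (restr n).
Proof. by []. Qed.
Fact restr_monoid n : monoid_morphism (restr n).
Proof. by split=> //; rewrite /restr /= mpolyC1. Qed.
HB.instance Definition _ n :=
  GRing.isZmodMorphism.Build Lam {mpoly K[n]} (restr n) (restr_zmod n).
HB.instance Definition _ n :=
  GRing.isMonoidMorphism.Build Lam {mpoly K[n]} (restr n) (restr_monoid n).

Definition elemS i : Lam := elem K i.+1.

Local Notation pevalE := (peval (in_alg Lam) elemS).

Lemma restr_peval n N (P : {mpoly K[N]}) :
  restr n (pevalE P) = peval (@mpolyC n K) (fun i => mesym n K i.+1) P.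
Proof.
rewrite peval_rmorph; congr (mmap _ _ _).
by apply: funext => a /=; rewrite /restr /= -mul_mpolyC mpolyC1 mulr1.
Qed.

Lemma peval_mesym n (P : {mpoly K[n]}) :
  peval (@mpolyC n K) (fun i => mesym n K i.+1) P
  = P \mPo [tuple mesym n K i.+1 | i < n].
Proof.
by congr (mmap _ _ _); apply: funext => i; rewrite tnth_mktuple.
Qed.

(** Truncating to as many variables as there are generators loses nothing, since e_1, ..., e_N are
    algebraically independent in N variables. *)
Lemma pevalE_inj N (P Q : {mpoly K[N]}) : restr N (pevalE P) = restr N (pevalE Q) -> P = Q.
Proof. by rewrite !restr_peval !peval_mesym => /msym_fundamental_un. Qed.

(** The last variable stands for e_(n+1), of weight n + 1, while [mweight] exceeds the largest
    weight by one; so that variable cannot occur. *)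
Lemma mwiden_mweight n (P : {mpoly K[n.+1]}) : (mweight P <= n.+1)%N ->
  exists Q : {mpoly K[n]}, P = mwiden Q.
Proof.
move=> h; exists (\sum_(m <- msupp P)
  P@_m *: 'X_[[multinom m (widen_ord (leqnSn n) i) | i < n]]).
rewrite {1}[P]mpolyE raddf_sum /= big_seq [RHS]big_seq; apply: eq_bigr => m mP.
rewrite mwidenZ mwidenX; congr (_ *: 'X_[_]); apply/mnmP => i.
have m0 : m ord_max = 0%N.
  have := leq_trans (mmeasure_mnm_lt (Measure.clone _ (@mnmwgt n.+1) _) mP) h.
  by rewrite /= /mnmwgt (bigD1 ord_max) //=; case: (m ord_max) => // a; nia.
have [-> |[j ->]] : i = ord_max \/ exists j, i = widen_ord (leqnSn n) j.
- have [lt|ge] := ltnP i n.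
    by right; exists (Ordinal lt); apply: val_inj.
  by left; apply: val_inj => /=; have := ltn_ord i; lia.
- by rewrite mnmwiden_ordmax.
by rewrite mnmwiden_widen mnmE.
Qed.

Lemma last0_restr n f : last0 (restr n.+1 f) = restr n f.
Proof. by rewrite /restr; have [_ ->] := symfunP f. Qed.

(* Writing f(x_1, ..., x_n) as a polynomial in e_1, ..., e_n, the weight bound
   shows that e_n does not occur for n larger than the degree of f, so that this
   polynomial stabilizes. *)
Lemma elem_generated f : generated (in_alg Lam) elemS f.
Proof.
have fS n : restr n f \is symmetric by rewrite /restr; have [->] := symfunP f.
have [d fd] : exists d, forall n, (msize (restr n f) <= d)%N.
  by have [_ _] := symfunP f.
have [Q [eQ _]] := sym_fundamental (fS d).
rewrite -peval_mesym -restr_peval in eQ; exists d, Q.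
move gE : (pevalE Q) eQ => g eQ; apply: symfun_inj => l.
rewrite -/(restr l f) -/(restr l g); apply/esym.
(* Agreement in [m] variables passes to fewer variables by setting some to 0; the rest of the proof
   climbs from [d] variables upwards. *)
have down m : restr m g = restr m f -> forall j, (j <= m)%N -> restr j g = restr j f.
  elim: m => [|m IH] em j; first by rewrite leqn0 => /eqP ->.
  rewrite leq_eqVlt => /orP[/eqP ->//|]; apply: IH.
  by rewrite -(last0_restr m g) -(last0_restr m f) em.
have [/(down _ eQ) //|/ltnW dl] := leqP l d.
elim: l dl => [|n IH]; first by move=> _; apply: (down _ eQ).
rewrite leq_eqVlt => /orP[/eqP <- //|dn]; have {IH} en := IH dn.
(* The weight bound removes e_(n+1) from the polynomial found in n + 1 variables. It and the padded
   [Q] then involve e_1, ..., e_n only, and agreement in [n] variables identifies them. *)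
have [P [eP wP]] := sym_fundamental (fS n.+1).
have [P' eP'] := mwiden_mweight (leq_trans wP (leq_trans (fd _) (leqW dn))).
rewrite -peval_mesym -restr_peval eP' peval_widen in eP.
have [Q' eQ'] := peval_pad Q dn.
have gE' : pevalE Q' = g := etrans (eQ' _ _ _) gE.
rewrite -eP -gE'; congr (restr _ (pevalE _)).
by apply: pevalE_inj; rewrite gE' en -(last0_restr n f) -eP last0_restr.
Qed.

End ElementaryGenerators.

Section Substitution.
Variables (K B : comNzRingType) (c : {rmorphism K -> B}) (x : nat -> B).
Local Notation Lam := (symfun K).

Lemma peval_elem_inj N M (P : {mpoly K[N]}) (Q : {mpoly K[M]}) :
  peval (in_alg Lam) (@elemS K) P = peval (in_alg Lam) (@elemS K) Q ->
  peval c x P = peval c x Q.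
Proof.
have [P' eP] := peval_pad P (leq_maxl N M); have [Q' eQ] := peval_pad Q (leq_maxr N M).
rewrite -!(eP, eQ) => /(congr1 (restr (maxn N M))) /pevalE_inj -> //.
Qed.

(** Freeness on the e_r: by [peval_elem_inj] the value does not depend on the polynomial chosen to
    represent a symmetric function. *)
Fact elem_subst_subproof : {s : Lam -> B | forall N (P : {mpoly K[N]}),
  s (peval (in_alg Lam) (@elemS K) P) = peval c x P}.
Proof.
have h f : exists b, exists N (P : {mpoly K[N]}),
    f = peval (in_alg Lam) (@elemS K) P /\ b = peval c x P.
  by have [N [P ->]] := elem_generated f; exists (peval c x P), N, P.
exists (fun f => projT1 (cid (h f))) => N P.
by case: cid => b /= [M [Q [e ->]]]; apply: peval_elem_inj.
Qed.

Definition elem_subst := sval elem_subst_subproof.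

Lemma elem_substE N (P : {mpoly K[N]}) :
  elem_subst (peval (in_alg Lam) (@elemS K) P) = peval c x P.
Proof. exact: (svalP elem_subst_subproof). Qed.

Fact elem_subst_zmod : zmod_morphism elem_subst.
Proof.
move=> f g.
have [N [P [Q [-> ->]]]] := generated2 (elem_generated f) (elem_generated g).
by rewrite -rmorphB !elem_substE rmorphB.
Qed.

Fact elem_subst_monoid : monoid_morphism elem_subst.
Proof.
split=> [|f g].
  by rewrite -(rmorph1 (peval (in_alg Lam) (@elemS K) (N := 0))) elem_substE rmorph1.
have [N [P [Q [-> ->]]]] := generated2 (elem_generated f) (elem_generated g).
by rewrite -rmorphM !elem_substE rmorphM.
Qed.

HB.instance Definition _ := GRing.isZmodMorphism.Build Lam B elem_subst elem_subst_zmod.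
HB.instance Definition _ := GRing.isMonoidMorphism.Build Lam B elem_subst elem_subst_monoid.

Lemma elem_substA a : elem_subst a%:A = c a.
Proof. by have := elem_substE (a%:MP_[0]); rewrite !peval_C. Qed.

Lemma elem_subst_elem i : elem_subst (elem K i.+1) = x i.
Proof. by have := elem_substE ('X_(@ord_max i)); rewrite !peval_X. Qed.

End Substitution.

(** * Newton's identities *)

Section Newton.
Variable B : comNzRingType.
Implicit Types e p : nat -> B.

(* p i stands for the power sum of degree i.+1 *)
Definition newton e p := e 0%N = 1 /\ forall n,
  n.+1%:R * e n.+1 = \sum_(i < n.+1) (-1) ^+ i * e (n - i)%N * p i.

Definition shift_seq e n : B := if n is m.+1 then e m else 0.

(* Multiplication of the generating series of e by 1 + x z. *)
Lemma newton_mulX e p x : newton e p ->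
  newton (fun n => e n + x * shift_seq e n) (fun i => p i + x ^+ i.+1).
Proof.
move=> [e0 eS]; split=> [|n]; first by rewrite /= mulr0 addr0.
have S3 : \sum_(i < n.+1) (-1) ^+ i * (e (n - i)%N + x * shift_seq e (n - i)%N)
    * x ^+ i.+1 = x * e n.
  elim: n => [|n IH]; first by rewrite big_ord1 /= expr0 expr1; ring.
  rewrite big_ord_recl /=; under eq_bigr => i _ do
    rewrite (_ : bump 0 i = i.+1) // subSS !(exprS _ i.+1) (exprS (-1)) mulN1r
      !mulNr mulrCA.
  by rewrite sumrN -mulr_sumr IH; ring.
have S2 : \sum_(i < n.+1) (-1) ^+ i * shift_seq e (n - i)%N * p i = n%:R * e n.
  rewrite big_ord_recr /= subnn /= mulr0 mul0r addr0.
  case: n {S3} => [|n]; first by rewrite big_ord0 mul0r.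
  by rewrite eS; apply: eq_bigr => i _; rewrite subSn // -ltnS.
transitivity (\sum_(i < n.+1) (-1) ^+ i * e (n - i)%N * p i
   + x * (\sum_(i < n.+1) (-1) ^+ i * shift_seq e (n - i)%N * p i)
   + \sum_(i < n.+1) (-1) ^+ i * (e (n - i)%N + x * shift_seq e (n - i)%N)
    * x ^+ i.+1).
  by rewrite S3 S2 -eS /= mulrDr -[n.+1%:R]natr1; ring.
rewrite mulr_sumr -!big_split; apply: eq_bigr => i _ /=.
by move: (x ^+ _) (_ ^+ i) => *; ring.
Qed.

(** As e_0 = 1, the power sum of largest index enters each identity with coefficient 1 or -1. In the
    converse [newton_eq_elem] a factor n + 1 has to be cancelled. *)
Lemma newton_eq_psum e p1 p2 : newton e p1 -> newton e p2 -> p1 =1 p2.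
Proof.
move=> [e0 h1] [_ h2] n; elim/ltn_ind: n => n IH.
have := h1 n; rewrite h2 !big_ord_recr /= subnn e0 mulr1.
under [X in _ = X + _ -> _]eq_bigr => i _ do rewrite IH //.
move/addrI => /(congr1 ( *%R ((-1) ^+ n))).
by rewrite !mulrA -expr2 -exprM mulnC exprM sqrrN expr1n expr1n !mul1r => ->.
Qed.

Lemma newton_eq_elem e1 e2 p : (forall n, GRing.lreg (n.+1%:R : B)) ->
  newton e1 p -> newton e2 p -> e1 =1 e2.
Proof.
move=> reg [e10 h1] [e20 h2]; elim/ltn_ind => [[|n]] IH; first by rewrite e10 e20.
apply: (reg n); rewrite h1 h2; apply: eq_bigr => i _.
by rewrite IH // ltnS leq_subr.
Qed.

Lemma newton_exists (inv : nat -> B) p : (forall n, n.+1%:R * inv n = 1) ->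
  exists e, newton e p.
Proof.
move=> invE.
(* The recursion for e_(n+1) uses all earlier values, so [es n] carries the list e_0, ..., e_n. *)
pose es := fix es n := if n is m.+1 then
  rcons (es m) (inv m * \sum_(i < m.+1) (-1) ^+ i * (es m)`_(m - i) * p i) else [:: 1].
have sz n : size (es n) = n.+1 by elim: n => //= n IH; rewrite size_rcons IH.
have nthE n m : (n <= m)%N -> (es m)`_n = (es n)`_n.
  elim: m => [|m IH]; first by rewrite leqn0 => /eqP ->.
  rewrite leq_eqVlt => /orP[/eqP -> //|h].
  by rewrite [es _ in LHS]/= nth_rcons sz h IH.
exists (fun n => (es n)`_n); split=> // n.
rewrite [es n.+1]/= nth_rcons sz ltnn eqxx mulrA invE mul1r.
by apply: eq_bigr => i _; rewrite nthE // leq_subr.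
Qed.

End Newton.

Lemma newton_rmorph (B C : comNzRingType) (f : {rmorphism B -> C}) (e p : nat -> B) :
  newton e p -> newton (f \o e) (f \o p).
Proof.
move=> [e0 h]; split=> [|n] /=; first by rewrite e0 rmorph1.
rewrite -(rmorph_nat f) -rmorphM h rmorph_sum.
by apply: eq_bigr => i _; rewrite !rmorphM rmorphXn rmorphN1.
Qed.

Section NewtonSymfun.
Variable K : comNzRingType.

(** Induction on the number of variables: a new variable x multiplies the generating series by 1 + x
    z. *)
Lemma newton_mesym n : newton (mesym n K) (fun i => \sum_(j < n) 'X_j ^+ i.+1).
Proof.
elim: n => [|n IH].
  split=> [|n]; first exact: mesym0E.
  rewrite mesym_geqnE // mulr0 big1 // => i _.
  by rewrite big_ord0 mulr0.
have := newton_mulX 'X_ord_max (newton_rmorph (@mwiden n K) IH).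
congr newton; apply: funext => i /=.
  case: i => [|i] /=; first by rewrite !mesym0E mwiden1 mulr0 addr0.
  by rewrite mesymSS mulrC.
rewrite big_ord_recr /= raddf_sum /=; congr (_ + _); apply: eq_bigr => j _.
by rewrite rmorphXn /= mwiden_Xi.
Qed.

Lemma newton_elem : newton (elem K) (psum K).
Proof.
split=> [|n]; apply: symfun_inj => m.
  by rewrite /= mesym0E mpolyC1.
rewrite -/(restr m _) -[RHS]/(restr m _) rmorphM rmorph_nat rmorph_sum.
have [_ e] := newton_mesym m; apply: (etrans (e n)); apply: eq_bigr => i _.
by rewrite !rmorphM rmorphXn rmorphN1.
Qed.

End NewtonSymfun.

(** * The power sums as free generators in characteristic zero *)

Section PowerSums.
Variables (K : fieldType).
Hypothesis natK : forall n, n.+1%:R != 0 :> K.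
Local Notation Lam := (symfun K).

Lemma nat_inv (B : comNzRingType) (c : {rmorphism K -> B}) n :
  n.+1%:R * c n.+1%:R^-1 = 1.
Proof. by rewrite -(rmorph_nat c) -rmorphM mulfV // rmorph1. Qed.

Lemma nat_lreg (B : comNzRingType) (c : {rmorphism K -> B}) n :
  GRing.lreg (n.+1%:R : B).
Proof.
move=> a b /(congr1 ( *%R (c n.+1%:R^-1))).
by rewrite !mulrA [c _ * _]mulrC nat_inv !mul1r.
Qed.

Lemma elem_psum r : generated (in_alg Lam) (psum K) (elem K r).
Proof.
have [e0 eS] := newton_elem K.
elim/ltn_ind: r => [[|r]] IH.
  by rewrite e0 -(rmorph1 (in_alg Lam)); apply: generatedC.
have -> : elem K r.+1 = in_alg Lam r.+1%:R^-1 * (r.+1%:R * elem K r.+1).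
  by rewrite mulrA [in_alg _ _ * _]mulrC nat_inv mul1r.
apply: generatedM; first exact: generatedC.
rewrite eS; apply: generated_sum => i; apply: generatedM; last exact: generatedX.
apply: generatedM; last by apply: IH; rewrite ltnS leq_subr.
by rewrite -(rmorphN1 (in_alg Lam)) -rmorphXn; apply: generatedC.
Qed.

Lemma psum_generated f : generated (in_alg Lam) (psum K) f.
Proof.
have [N [P ->]] := elem_generated f; apply: generated_peval => i; exact: elem_psum.
Qed.

Lemma symfun_rmorph_ext (B : comNzRingType) (f g : {rmorphism Lam -> B}) :
  (forall a, f a%:A = g a%:A) -> (forall r, f (psum K r) = g (psum K r)) -> f =1 g.
Proof.
move=> fgA fgp x; have [N [P ->]] := psum_generated x; rewrite !peval_rmorph.
congr (mmap _ _ _); [exact: funext|apply: funext => i; exact: fgp].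
Qed.

Variables (B : comNzRingType) (c : {rmorphism K -> B}) (p : nat -> B).

(** Newton's identities are solved in [B] for a sequence [e] with the prescribed power sums. Sending
    the e_r to it is possible by freeness, and the images of the power sums are then forced. *)
Fact psum_subst_subproof : {f : {rmorphism Lam -> B} |
  (forall a, f a%:A = c a) /\ (forall r, f (psum K r) = p r)}.
Proof.
apply: cid; have [e eP] := newton_exists p (@nat_inv B c).
exists (elem_subst c (fun i => e i.+1)); split=> [a|]; first exact: elem_substA.
have h := newton_rmorph (elem_subst c (fun i => e i.+1)) (newton_elem K).
have [e0 _] := eP; apply: (newton_eq_psum h); move: eP.
congr newton; apply: funext => [[|i]] /=.
  by have [-> _] := newton_elem K; rewrite rmorph1.
by rewrite elem_subst_elem.
Qed.

Definition psum_subst : {rmorphism Lam -> B} := sval psum_subst_subproof.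

Lemma psum_substA a : psum_subst a%:A = c a.
Proof. by have [-> _] := svalP psum_subst_subproof. Qed.

Lemma psum_subst_psum r : psum_subst (psum K r) = p r.
Proof. by have [_ ->] := svalP psum_subst_subproof. Qed.

Lemma psum_subst_peval N (P : {mpoly K[N]}) :
  psum_subst (peval (in_alg Lam) (psum K) P) = peval c p P.
Proof.
rewrite peval_rmorph; congr (mmap _ _ _); apply: funext => a /=; first exact: psum_substA.
exact: psum_subst_psum.
Qed.

End PowerSums.

(** * The positive cone *)

Section Cycles.
Variables (R : comNzRingType) (q : R).

Local Notation heckeS := (heckeS q).
Local Notation X := (xvar R).

Lemma heckeS_mulXn k i m (F : {mpoly R[k]}) : (i.+1 < k)%N ->
  heckeS i (X k i.+1 ^+ m * F) = X k i ^+ m * heckeS i F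
    + (q%:MP - 1) * \sum_(l < m) X k i ^+ (m - l) * X k i.+1 ^+ l * F.
Proof.
move=> h; elim: m F => [|m IH] F; first by rewrite big_ord0 mulr0 addr0 !mul1r.
(* T commutes with the symmetric x_i + x_(i+1); subtracting the known rule for x_i gives the rule
   for x_(i+1) under T. *)
have sy : heckeS i ((X k i + X k i.+1) * F) = (X k i + X k i.+1) * heckeS i F.
  apply: heckeS_Ml => // a b ea eb; rewrite -eb -ea !xvarE msymD !msymXi tpermL tpermR.
  exact: addrC.
have := heckeS_XnS q 1 F h; rewrite big_ord1 /= subnn expr0 mulr1 !expr1 => eT.
rewrite mulrDl heckeSD // in sy.
rewrite exprSr -mulrA IH big_ord_recl /= subn0 expr0 mulr1.
set S1 := \sum_(l < m) _; have -> : S1 =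
    \sum_(l < m) X k i ^+ (m.+1 - bump 0 l) * X k i.+1 ^+ bump 0 l * F.
  by apply: eq_bigr => l _; rewrite (_ : bump 0 l = l.+1) // subSS exprSr; mring.
move: (\sum_(l < m) _) => S2; rewrite [in RHS]exprSr.
apply: (eq_of_subr (congr1 ( *%R (X k i ^+ m))
  (congr2 +%R sy eT))).
mring.
Qed.

Lemma heckeS0 k i : (i.+1 < k)%N -> heckeS i 0 = 0 :> {mpoly R[k]}.
Proof. by move=> h; apply: (addrI (heckeS i 0)); rewrite -heckeSD // !addr0. Qed.

Lemma heckeS_sum k i I (r : seq I) (F : I -> {mpoly R[k]}) : (i.+1 < k)%N ->
  heckeS i (\sum_(j <- r) F j) = \sum_(j <- r) heckeS i (F j).
Proof.
move=> h; elim: r => [|j r IH]; first by rewrite !big_nil heckeS0.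
by rewrite !big_cons heckeSD // IH.
Qed.

Lemma heckeS1 k i : (i.+1 < k)%N -> heckeS i 1 = 1 :> {mpoly R[k]}.
Proof.
move=> h; rewrite (heckeS_ord q (ltnW h) h); apply: heckeP; last by rewrite msym1; mring.
by rewrite -val_eqE /= ltn_eqF.
Qed.

(* T_j T_(j+1) ... T_(m-1), with operators and variables indexed from 0 *)
Definition hcycle k (j m : nat) (F : {mpoly R[k]}) := foldr (@heckeS k) F (iota j (m - j)).

Lemma hcycle_ge k j m (F : {mpoly R[k]}) : (m <= j)%N -> hcycle j m F = F.
Proof. by rewrite /hcycle -subn_eq0 => /eqP ->. Qed.

Lemma hcycleSl k j m (F : {mpoly R[k]}) : (j < m)%N ->
  hcycle j m F = heckeS j (hcycle j.+1 m F).
Proof. by move=> h; rewrite /hcycle -{1}(subnSK h). Qed.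

Lemma hcycleSr k j m (F : {mpoly R[k]}) : (j <= m)%N ->
  hcycle j m.+1 F = hcycle j m (heckeS m F).
Proof.
by move=> h; rewrite /hcycle subSn // -addn1 iotaD foldr_cat /= subnKC.
Qed.

Lemma hcycleD k j m (F G : {mpoly R[k]}) : (m < k)%N ->
  hcycle j m (F + G) = hcycle j m F + hcycle j m G.
Proof.
elim: m F G => [|m IH] F G h; first by rewrite !hcycle_ge.
have [jm|jm] := leqP j m; last by rewrite !hcycle_ge.
by rewrite !hcycleSr // heckeSD // IH // ltnW.
Qed.

Lemma hcycle_sum k j m I (r : seq I) (F : I -> {mpoly R[k]}) : (m < k)%N ->
  hcycle j m (\sum_(i <- r) F i) = \sum_(i <- r) hcycle j m (F i).
Proof.
elim: m F => [|m IH] F h.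
  by rewrite hcycle_ge //; apply: eq_bigr => i _; rewrite hcycle_ge.
have [jm|jm] := leqP j m.
  rewrite hcycleSr // heckeS_sum // IH; last exact: ltnW.
  by apply: eq_bigr => i _; rewrite hcycleSr.
by rewrite hcycle_ge //; apply: eq_bigr => i _; rewrite hcycle_ge.
Qed.

Lemma hcycle_Ml k j m (H F : {mpoly R[k]}) : (m < k)%N ->
  (forall i G, (j <= i < m)%N -> heckeS i (H * G) = H * heckeS i G) ->
  hcycle j m (H * F) = H * hcycle j m F.
Proof.
elim: m F => [|m IH] F h e; first by rewrite !hcycle_ge.
have [jm|jm] := leqP j m; last by rewrite !hcycle_ge.
rewrite !hcycleSr // e ?jm ?leqnn // IH //; first exact: ltnW.
by move=> i G /andP[ji im]; rewrite e // ji ltnW.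
Qed.

Lemma hcycle_C k j m c (F : {mpoly R[k]}) : (m < k)%N ->
  hcycle j m (c%:MP * F) = c%:MP * hcycle j m F.
Proof. by move=> h; apply: hcycle_Ml => // i G ij; apply: heckeS_C; lia. Qed.

Lemma hcycle_Xn k j m l a (F : {mpoly R[k]}) : (m < l)%N -> (m < k)%N ->
  hcycle j m (X k l ^+ a * F) = X k l ^+ a * hcycle j m F.
Proof. by move=> ml mk; apply: hcycle_Ml => // i G ij; apply: heckeS_Xn; lia. Qed.

Lemma hcycle_widen k j m (F : {mpoly R[k]}) : (m < k)%N ->
  mwiden (hcycle j m F) = hcycle j m (mwiden F).
Proof.
elim: m F => [|m IH] F h; first by rewrite !hcycle_ge.
have [jm|jm] := leqP j m; last by rewrite !hcycle_ge.
by rewrite !hcycleSr // IH ?heckeS_widen // ltnW.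
Qed.

Lemma hcycle_heckeS_lt k j m i (F : {mpoly R[k]}) : (m < i)%N -> (i.+1 < k)%N ->
  hcycle j m (heckeS i F) = heckeS i (hcycle j m F).
Proof.
elim: m F => [|m IH] F h1 h2; first by rewrite !hcycle_ge.
have [jm|jm] := leqP j m; last by rewrite !hcycle_ge.
by rewrite !hcycleSr // heckeS_comm // IH // ltnW.
Qed.

(** [T_i] commutes leftwards with the factors of index above i + 1, becomes [T_(i+1)] by the braid
    relation at i, i + 1, and then commutes with the remaining factors. *)
Lemma hcycle_heckeS k j m i (F : {mpoly R[k]}) : (j <= i)%N -> (i.+1 < m)%N -> (m < k)%N ->
  hcycle j m (heckeS i F) = heckeS i.+1 (hcycle j m F).
Proof.
elim: m F => [//|m IH] F ji im mk.
have jm : (j <= m)%N by lia.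
rewrite !hcycleSr //; case: (ltnP i.+1 m) => h.
  by rewrite -heckeS_comm // IH // ltnW.
have em : m = i.+1 by lia.
rewrite em in mk jm *; rewrite !hcycleSr // heckeS_braid //.
by rewrite hcycle_heckeS_lt.
Qed.

Lemma hcycle_hcycle k j l m (F : {mpoly R[k]}) : (j <= l <= m)%N -> (m.+1 < k)%N ->
  hcycle j m.+1 (hcycle l m F) = hcycle l.+1 m.+1 (hcycle j m.+1 F).
Proof.
move=> /andP[jl lm] mk.
elim: {l lm}(m - l)%N {-2}l (erefl (m - l)%N) jl lm => [|d IH] l e jl lm.
  have -> : l = m by lia.
  by rewrite (hcycle_ge _ (leqnn m)) (hcycle_ge _ (leqnn m.+1)).
have h : (l < m)%N by lia.
rewrite (hcycleSl _ h) (@hcycleSl _ l.+1 m.+1) // hcycle_heckeS // IH //; lia.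
Qed.

End Cycles.

(** * Moving T_j ... T_(k-1) x_k^i past the insertion of a variable *)

Section Rotations.
Variables (R : comNzRingType) (q : R).

Local Notation heckeS := (heckeS q).
Local Notation hcycle := (hcycle q).
Local Notation X := (xvar R).

(** The case j = 0, i = 1 is phi after the twist. The other members appear when d_- is moved past
    [hins], and moving one member past [hins] gives members again. *)
Definition hrot k j i (F : {mpoly R[k.+1]}) := hcycle j k (X k.+1 k ^+ i * F).

(* The operator D_j,a of the header. *)
Definition hins k j a (g : {mpoly R[k]}) := hrot j a (mwiden g).

Lemma hrotD k j i (F G : {mpoly R[k.+1]}) : hrot j i (F + G) = hrot j i F + hrot j i G.
Proof. by rewrite /hrot mulrDr hcycleD. Qed.

Lemma hrot0 k j i : hrot j i (0 : {mpoly R[k.+1]}) = 0.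
Proof. by apply: (addrI (hrot j i 0)); rewrite -hrotD !addr0. Qed.

Lemma hrot_C k j i c (F : {mpoly R[k.+1]}) : hrot j i (c%:MP * F) = c%:MP * hrot j i F.
Proof. by rewrite /hrot mulrCA hcycle_C. Qed.

Lemma hins_C k j a c (g : {mpoly R[k]}) : hins j a (c%:MP * g) = c%:MP * hins j a g.
Proof. by rewrite /hins mwidenM mwidenC hrot_C. Qed.

Lemma hrot_hins_last k j i a (g : {mpoly R[k]}) : hrot j i (hins k a g) = hins j (a + i) g.
Proof. by rewrite /hins /hrot (@hcycle_ge _ q _ k k) // mulrA -exprD addnC. Qed.

(** Only the innermost T of [hins] fails to commute with the power of the last variable. Each
    correction term leaves a shorter chain T_l ... T_(k-1) acting on [g], which regroups as an
    insertion of [hrot l m.+1 g]. *)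
Lemma hrot_hins k j l i a (g : {mpoly R[k.+1]}) : (l <= k)%N ->
  hrot j i (hins l a g) =
    hcycle j k.+1 (hcycle l k.+1 (X k.+2 k ^+ i * (X k.+2 k.+1 ^+ a * mwiden g)))
    + (q%:MP - 1) * \sum_(m < i) hins j (a + (i - m.+1)) (hrot l m.+1 g).
Proof.
move=> lk; rewrite {1}/hrot {1}/hins {1}/hrot [hcycle l k.+1 (X _ _ ^+ a * _)]hcycleSr //.
rewrite -hcycle_Xn // heckeS_XnS // !hcycleD // -hcycleSr //; congr (_ + _).
rewrite -[1]mpolyC1 -mpolyCB !hcycle_C //; congr (_ * _).
rewrite !hcycle_sum //; apply: eq_bigr => m _.
rewrite /hins /hrot hcycle_widen // mwidenM rmorphXn /= xvar_widen //.
rewrite -hcycle_Xn //; congr (hcycle _ _ (hcycle _ _ _)).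
by rewrite addnC exprD; mring.
Qed.

(** For l <= j, [hcycle_hcycle] read from right to left exchanges the two chains in the main term
    without squaring any T. *)
Lemma hrot_hins_lt k j l i a (g : {mpoly R[k.+1]}) : (l <= j)%N -> (j <= k)%N ->
  hrot j.+1 i (hins l a g) = hins l a (hrot j i g)
    + (q%:MP - 1) * \sum_(m < i) hins j.+1 (a + (i - m.+1)) (hrot l m.+1 g).
Proof.
move=> lj jk; rewrite hrot_hins ?(leq_trans lj) //; congr (_ + _).
rewrite -hcycle_hcycle ?lj // {1}/hins /hrot; congr (hcycle _ _ _).
by rewrite hcycle_widen // mwidenM rmorphXn /= xvar_widen // -hcycle_Xn // mulrCA.
Qed.

(* The last summand of hrot_hins is cancelled by the negative term of
   T^2 = q - (q - 1) T. *)
Lemma hrot_hins_ge k j l i a (g : {mpoly R[k.+1]}) : (j <= l)%N -> (l <= k)%N ->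
  hrot j i.+1 (hins l a g) = q%:MP * hins l.+1 a (hrot j i.+1 g)
    + (q%:MP - 1) * \sum_(m < i) hins j (a + (i - m)) (hrot l m.+1 g).
Proof.
(* The summand m = i is isolated: it is the one to be cancelled, and it exists because the exponent
   is positive. *)
move=> jl lk; rewrite hrot_hins // big_ord_recr /= subnn addn0.
have insE j' : (j' <= k)%N ->
    hcycle j' k (X k.+2 k ^+ i.+1 * (X k.+2 k.+1 ^+ a * mwiden g))
    = X k.+2 k.+1 ^+ a * mwiden (hrot j' i.+1 g).
  move=> h; rewrite mulrCA hcycle_Xn // /hrot hcycle_widen //.
  by rewrite mwidenM rmorphXn /= xvar_widen.
(* For j <= l the braid relations bring the two factors of index [k] next to each other, where the
   quadratic relation applies. *)
rewrite [hcycle l k.+1 _]hcycleSr // hcycle_hcycle ?jl //.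
rewrite [hcycle j k.+1 _]hcycleSr ?(leq_trans jl) //.
rewrite heckeS_quad // -[1]mpolyC1 -mpolyCB -mulNr -mpolyCN !hcycleD // !hcycle_C //.
rewrite insE ?(leq_trans jl) // -/(hrot _ _ _) -/(hins _ _ _).
rewrite -hcycleSr ?(leq_trans jl) // -hcycle_hcycle ?jl // insE //.
rewrite -/(hrot _ _ _) -/(hins _ _ _).
under eq_bigr => m _ do rewrite subSS.
by rewrite mulrDr mpolyCN mulNr addrACA addNr addr0.
Qed.

End Rotations.

Section LastVariable.
Variable R : comNzRingType.

Local Notation X := (xvar R).

Lemma xvar_last k : X k.+1 k = 'X_ord_max.
Proof. by rewrite (xvar_ord _ (ltnSn k)); congr 'X_(_); apply: val_inj. Qed.

Lemma muni_last k : muni ('X_ord_max : {mpoly R[k.+1]}) = 'X.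
Proof.
rewrite muniE msuppX big_seq1 mcoeffX eqxx scale1r mnm1E eqxx expr1.
have -> : [multinom U_(ord_max : 'I_k.+1)%MM (widen_ord (leqnSn k) i) | i < k] = 0%MM.
  apply/mnmP => i; rewrite !mnmE; case: eqP => // /(congr1 val) /=.
  by have := ltn_ord i; lia.
by rewrite mpolyX0 scale1r.
Qed.

Lemma muni_widen k (g : {mpoly R[k]}) : muni (mwiden g) = g%:P.
Proof.
pose f1 : {rmorphism _ -> {poly {mpoly R[k]}}} := @muni k R \o @mwiden k R.
apply: (mpoly_rmorph_ext (f := f1) (g := polyC)) => [c|i] /=.
  by rewrite mwidenC muniC.
rewrite mwidenX muniE msuppX big_seq1 mcoeffX eqxx scale1r.
rewrite mnmwiden_ordmax expr0 alg_polyC; congr _%:P; congr 'X_[_].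
by apply/mnmP => l; rewrite mnmE mnmwiden_widen.
Qed.

Lemma mpoly_last_ind k (Q : {mpoly R[k.+1]} -> Prop) :
  Q 0 -> (forall F G, Q F -> Q G -> Q (F + G)) ->
  (forall a g, Q (X k.+1 k ^+ a * mwiden g)) -> forall F, Q F.
Proof.
move=> Q0 QD Qm; elim/mpolyind => [//|c m p _ _ IH]; apply: (QD) => //.
suff -> : c *: 'X_[m] = X k.+1 k ^+ m ord_max
    * mwiden (c%:MP * \prod_(i < k) 'X_i ^+ m (widen_ord (leqnSn k) i)) by [].
rewrite mwidenM mwidenC mulrCA mul_mpolyC; congr (_ *: _).
rewrite mpolyXE_id big_ord_recr /= xvar_last mulrC; congr (_ * _).
by rewrite rmorph_prod; apply: eq_bigr => i _; rewrite rmorphXn /= mwiden_Xi.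
Qed.

End LastVariable.

(** Sums without coefficients suffice: the generators of the cone will be stable under positive
    scalars, as these can be moved inside [hins]. *)
Inductive nspan (V : nmodType) (S : V -> Prop) : V -> Prop :=
| nspan0 : nspan S 0
| nspanD x y : S x -> nspan S y -> nspan S (x + y).

Lemma nspan_add (V : nmodType) (S : V -> Prop) x y :
  nspan S x -> nspan S y -> nspan S (x + y).
Proof.
by elim=> [|u v Su _ IH] Sy; [rewrite add0r|rewrite -addrA; apply: nspanD; last exact: IH].
Qed.

Lemma nspan_gen (V : nmodType) (S : V -> Prop) x : S x -> nspan S x.
Proof. by move=> Sx; rewrite -[x]addr0; apply: nspanD => //; apply: nspan0. Qed.

(** * The lowering operator and its commutation with insertions *)

Section Lowering.
Variables (R : comNzRingType) (q : R) (w : forall k, nat -> {mpoly R[k]}).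
Hypothesis w0 : forall k, w k 0 = 1.
Hypothesis w_sym : forall k j, w k j \is symmetric.
(** With W_k(u) = sum_j w_(k,j) u^j and x the new variable, this reads (1 - q x u) W_(k+1)(u) = (1 -
    x u) W_k(u). *)
Hypothesis w_rec : forall k j, w k.+1 j.+1 - q%:MP * xvar R k.+1 k * w k.+1 j
  = mwiden (w k j.+1) - xvar R k.+1 k * mwiden (w k j).

Local Notation X := (xvar R).
Local Notation heckeS := (heckeS q).
Local Notation hcycle := (hcycle q).
Local Notation hrot := (hrot q).
Local Notation hins := (hins q).

(** Coefficients of (1 - x u) / (1 - q x u) = 1 + (q - 1) sum_(i >= 0) q^i (x u)^(i+1). *)
Lemma w_up k j : w k.+1 j = mwiden (w k j)
  + (q%:MP - 1) * \sum_(i < j) q%:MP ^+ i * X k.+1 k ^+ i.+1 * mwiden (w k (j - i.+1)).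
Proof.
elim: j => [|j IH]; first by rewrite big_ord0 mulr0 addr0 !w0 mwiden1.
rewrite big_ord_recl /= subn1 /= expr0 expr1 mul1r.
under eq_bigr => i _ do rewrite /bump /= add1n subSS exprS [X _ _ ^+ _]exprS.
have := w_rec k j; rewrite IH => e.
pose S1 := \sum_(i < j) q%:MP ^+ i * X k.+1 k ^+ i.+1 * mwiden (w k (j - i.+1)).
have -> : \sum_(i < j) q%:MP * q%:MP ^+ i * (X k.+1 k * X k.+1 k ^+ i.+1)
            * mwiden (w k (j - i.+1)) = q%:MP * X k.+1 k * S1.
  by rewrite mulr_sumr; apply: eq_bigr => i _; mring.
rewrite -/S1 in e; move: S1 e => S1 e.
apply: (eq_of_subr e); move: (w k.+1 j.+1) (X _ _) S1 {e} => a b c; mring.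
Qed.

(** Coefficients of the inverse factor (1 - q x u) / (1 - x u) = 1 - (q - 1) sum_(i > 0) (x u)^i.
    Its minus sign serves to absorb that of T in [lowering_heckeS_mon]. *)
Lemma w_down k j : mwiden (w k j.+1) = w k.+1 j.+1
  - (q%:MP - 1) * \sum_(p < j.+1) X k.+1 k ^+ (j - p).+1 * w k.+1 p.
Proof.
elim: j => [|j IH].
  have := w_rec k 0; rewrite !w0 mwiden1 big_ord1 /= expr1 w0 => e.
  apply: (eq_of_subr (esym e)); move: (w _ _) (X _ _) {e} => a b; mring.
rewrite big_ord_recr /= subnn expr1.
have -> : \sum_(p < j.+1) X k.+1 k ^+ (j.+1 - p).+1 * w k.+1 p
    = X k.+1 k * \sum_(p < j.+1) X k.+1 k ^+ (j - p).+1 * w k.+1 p.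
  by rewrite mulr_sumr; apply: eq_bigr => p _; rewrite subSn -1?ltnS // exprS mulrA.
move: IH; set S1 := \sum_(p < _) _ => IH.
apply: (eq_of_subr (congr2 +%R (esym (w_rec k j.+1)) (congr1 ( *%R (X k.+1 k)) IH))).
move: (w _ _) (w _ _) (X _ _) S1 {IH} => a b c d; mring.
Qed.

Definition lowering k (F : {mpoly R[k.+1]}) : {mpoly R[k]} :=
  \sum_(j < size (muni F)) w k j.+1 * (muni F)`_j.

Lemma lowering_bound k N (F : {mpoly R[k.+1]}) : (size (muni F) <= N)%N ->
  lowering F = \sum_(j < N) w k j.+1 * (muni F)`_j.
Proof.
move=> h; rewrite /lowering (big_ord_widen N (fun j => w k j.+1 * (muni F)`_j)) //.
rewrite big_mkcond; apply: eq_bigr => j _; case: ltnP => // sj.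
by rewrite nth_default // mulr0.
Qed.

Lemma loweringD k (F G : {mpoly R[k.+1]}) : lowering (F + G) = lowering F + lowering G.
Proof.
pose N := maxn (size (muni F)) (size (muni G)).
have hF : (size (muni F) <= N)%N by apply: leq_maxl.
have hG : (size (muni G) <= N)%N by apply: leq_maxr.
have hFG : (size (muni (F + G)) <= N)%N by rewrite muniD; apply: size_polyD.
rewrite (lowering_bound hF) (lowering_bound hG) (lowering_bound hFG) -big_split.
by apply: eq_bigr => j _ /=; rewrite muniD coefD mulrDr.
Qed.

Lemma lowering0 k : lowering (0 : {mpoly R[k.+1]}) = 0.
Proof. by apply: (addrI (lowering 0)); rewrite -loweringD !addr0. Qed.

Lemma lowering_sum k I (r : seq I) (F : I -> {mpoly R[k.+1]}) :
  lowering (\sum_(i <- r) F i) = \sum_(i <- r) lowering (F i).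
Proof.
elim: r => [|i r IH]; first by rewrite !big_nil lowering0.
by rewrite !big_cons loweringD IH.
Qed.

Lemma lowering_Ml k g (F : {mpoly R[k.+1]}) : lowering (mwiden g * F) = g * lowering F.
Proof.
have sz : (size (muni (mwiden g * F)) <= size (muni F))%N.
  rewrite muniM muni_widen mul_polyC; exact: size_scale_leq.
rewrite (lowering_bound sz) mulr_sumr; apply: eq_bigr => j _.
by rewrite muniM muni_widen coefCM mulrCA.
Qed.

Lemma lowering_Xn k a : lowering (X k.+1 k ^+ a) = w k a.+1.
Proof.
rewrite /lowering xvar_last rmorphXn /= muni_last size_polyXn big_ord_recr /=.
rewrite coefXn eqxx mulr1 big1 ?add0r // => i _.
by rewrite coefXn ltn_eqF // mulr0.
Qed.

(** [lowering] is linear over the polynomials in the first [k] variables, and its values [w k _] are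
    symmetric in them. *)
Lemma lowering_heckeS k i (F : {mpoly R[k.+1]}) : (i.+1 < k)%N ->
  lowering (heckeS i F) = heckeS i (lowering F).
Proof.
move=> h; elim/mpoly_last_ind: F => [|F G eF eG|a g].
- by rewrite lowering0 !heckeS0 ?lowering0 // ltnW.
- by rewrite loweringD !heckeSD ?loweringD ?eF ?eG // ltnW.
rewrite heckeS_Xn ?(ltnW h) ?gtn_eqF // -?heckeS_widen //; last exact: ltnW.
rewrite !(mulrC (X _ _ ^+ a)) !lowering_Ml lowering_Xn ![_ * w _ _]mulrC heckeS_Ml //.
  by move=> b c _ _; apply/issymP.
exact: ltnW.
Qed.

Lemma lowering_hcycle k j m (F : {mpoly R[k.+1]}) : (m < k)%N ->
  lowering (hcycle j m F) = hcycle j m (lowering F).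
Proof.
elim: m F => [|m IH] F h; first by rewrite !hcycle_ge.
have [jm|jm] := leqP j m; last by rewrite !hcycle_ge.
by rewrite !hcycleSr // IH ?lowering_heckeS // ltnW.
Qed.

Lemma lowering_mon k G m :
  lowering (mwiden G * X k.+1 k ^+ m) = G * w k m.+1.
Proof. by rewrite lowering_Ml lowering_Xn. Qed.

(** The terms with - (q - 1) come from T(x_k^b). After lowering they are those of [w_down], turning
    [w k.+1 b.+1] into the widened [w k b.+1], except for the term in x_k^(a+b+1), which accounts
    for the summand p = a on the right. *)
Lemma lowering_heckeS_mon k a b :
  lowering (heckeS k (X k.+2 k.+1 ^+ a * X k.+2 k ^+ b))
  = X k.+1 k ^+ a * mwiden (w k b.+1)
    + (q%:MP - 1) * (\sum_(p < a.+1) X k.+1 k ^+ p.+1 * w k.+1 (a - p)) * X k.+1 k ^+ b.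
Proof.
have eb : heckeS k (X k.+2 k ^+ b) = X k.+2 k.+1 ^+ b
    - (q%:MP - 1) * \sum_(l < b) X k.+2 k ^+ l.+1 * X k.+2 k.+1 ^+ (b - l.+1).
  have := heckeS_XnS q b 1 (ltnSn k.+1); rewrite heckeS1 // !mulr1 => ->.
  by rewrite -addrA -mulrBr -sumrB big1 ?mulr0 ?addr0 // => l _; rewrite mulr1 subrr.
pose y := X k.+1 k; pose z := X k.+2 k.+1; pose s : {mpoly R[k.+1]} := q%:MP - 1.
have sE : q%:MP - 1 = mwiden s by rewrite mwidenB mwidenC mwiden1.
have yE : X k.+2 k = mwiden y by rewrite xvar_widen.
have -> : heckeS k (X k.+2 k.+1 ^+ a * X k.+2 k ^+ b) =
    mwiden (y ^+ a) * z ^+ b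
    + (\sum_(l < b) mwiden (- (s * y ^+ a * y ^+ l.+1)) * z ^+ (b - l.+1)
       + \sum_(l < a) mwiden (s * y ^+ (a - l) * y ^+ b) * z ^+ l).
  rewrite heckeS_mulXn // eb sE yE mulrBr -addrA rmorphXn; congr (_ + (_ + _)).
    rewrite mulrCA mulrA !mulr_sumr -sumrN; apply: eq_bigr => l _.
    by rewrite mwidenN !mwidenM !rmorphXn /=; move: (_ ^+ (b - _)); mring.
  rewrite mulr_sumr; apply: eq_bigr => l _.
  by rewrite !mwidenM !rmorphXn /=; move: (_ ^+ (a - _)); mring.
rewrite !loweringD !lowering_sum lowering_mon.
under eq_bigr => l _ do rewrite lowering_mon -subSn // subSS.
under [X in _ + (_ + X)]eq_bigr => l _ do rewrite lowering_mon.
rewrite w_down [\sum_(p < a.+1) _]big_ord_recr /= subnn w0 mulr1.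
pose Ha := \sum_(p < a) y ^+ p.+1 * w k.+1 (a - p).
pose Hb := \sum_(p < b) y ^+ p.+1 * w k.+1 (b - p).
rewrite [\sum_(p < b.+1) _](_ : _ = Hb + y ^+ b.+1); last first.
  rewrite big_ord_recl /= subn0 w0 mulr1 addrC; congr (_ + _).
  rewrite (reindex_inj rev_ord_inj); apply: eq_bigr => l _ /=.
  by rewrite /bump /= add1n; congr (_ ^+ _.+1 * w _ _); have := ltn_ord l; lia.
rewrite [\sum_(p < b) _](_ : _ = - (s * y ^+ a * Hb)); last first.
  rewrite -mulNr mulr_sumr; apply: eq_bigr => l _.
  by rewrite mulNr; move: (w _ _); mring.
rewrite [\sum_(p < a) _ in LHS](_ : _ = s * y ^+ b * Ha); last first.
  rewrite mulr_sumr (reindex_inj rev_ord_inj); apply: eq_bigr => l _ /=.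
  rewrite subnSK ?ltn_ord // subKn ?ltn_ord //.
  by move: (w _ _); mring.
rewrite -/y -/Ha; move: Ha Hb (w _ _) => {eb sE yE} Ha Hb W; rewrite /s !exprSr.
by move: y (y ^+ a) (y ^+ b) => y ya yb; mring.
Qed.

Lemma lowering_heckeS_last k a (f : {mpoly R[k.+1]}) :
  lowering (heckeS k (X k.+2 k.+1 ^+ a * mwiden f)) = X k.+1 k ^+ a * mwiden (lowering f)
    + (q%:MP - 1) * (\sum_(p < a.+1) X k.+1 k ^+ p.+1 * w k.+1 (a - p)) * f.
Proof.
elim/mpoly_last_ind: f => [|f g ef eg|b g].
- by rewrite mwiden0 lowering0 mwiden0 !mulr0 heckeS0 // lowering0 addr0.
- rewrite mwidenD mulrDr heckeSD // loweringD ef eg loweringD mwidenD mulrDr.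
  by rewrite addrACA -!mulrDr.
have -> : X k.+2 k.+1 ^+ a * mwiden (X k.+1 k ^+ b * mwiden g)
   = mwiden (mwiden g) * (X k.+2 k.+1 ^+ a * X k.+2 k ^+ b).
  by rewrite mwidenM rmorphXn /= xvar_widen // mulrA mulrC.
(* [g] involves only the first [k] variables, and this T exchanges the two after them. *)
rewrite heckeS_Ml //; last first.
  move=> c d ec ed; elim/mpolyind: g => [|x m p _ _ IH].
    by rewrite !mwiden0 msym0.
  rewrite !mwidenD !mwidenZ msymD msymZ IH; congr (_ *: _ + _).
  rewrite mpolyXE_id !rmorph_prod /=; apply: eq_bigr => i _.
  rewrite !rmorphXn /= !mwiden_Xi msymXi; congr ('X_(_) ^+ _).
  by rewrite tpermD // -val_eqE /= ?ec ?ed; have := ltn_ord i; lia.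
rewrite lowering_Ml lowering_heckeS_mon [X in lowering X]mulrC lowering_mon mwidenM.
move: (\sum_(p < _) _) (_ ^+ a) (_ ^+ b) => S1 ya yb; mring.
Qed.

Lemma lowering_hins_last k a (g : {mpoly R[k]}) : lowering (hins k a g) = w k a.+1 * g.
Proof. by rewrite /hins /hrot (@hcycle_ge _ q _ k k) // mulrC lowering_mon mulrC. Qed.

(** The correction is the commutator of d_- with D_j,a, and only positive exponents of [hrot] occur
    in it. *)
Lemma lowering_hins k j a (g : {mpoly R[k.+1]}) : (j <= k)%N ->
  lowering (hins j a g) = hins j a (lowering g)
    + (q%:MP - 1) * \sum_(p < a.+1) w k.+1 (a - p) * hrot j p.+1 g.
Proof.
move=> jk; rewrite {1}/hins {1}/hrot hcycleSr // lowering_hcycle //.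
rewrite lowering_heckeS_last hcycleD //.
congr (_ + _); rewrite -[1]mpolyC1 -mpolyCB -mulrA hcycle_C //; congr (_ * _).
rewrite mulr_suml hcycle_sum //; apply: eq_bigr => p _.
rewrite -mulrA mulrCA /hrot; apply: hcycle_Ml => // i G /andP[_ ik].
by apply: heckeS_Ml => // b c _ _; apply/issymP.
Qed.

(** * Stability of the cone *)

Variable P : R -> Prop.
Hypotheses (P0 : P 0) (P1 : P 1) (PD : forall x y, P x -> P y -> P (x + y)).
Hypotheses (PM : forall x y, P x -> P y -> P (x * y)) (Pq : P (q - 1)).
Hypothesis Pw : forall j, P (w 0 j)@_0.

Fixpoint cone k : {mpoly R[k]} -> Prop :=
  match k with
  | 0 => fun F => P F@_0
  | k'.+1 => nspan (fun F => exists j a g,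
      [/\ (j <= k')%N, cone g & F = hins j a g])
  end.

Lemma cone0 k : cone (0 : {mpoly R[k]}).
Proof. by case: k => [|k]; [rewrite /= mcoeff0|exact: nspan0]. Qed.

Lemma coneD k (F G : {mpoly R[k]}) : cone F -> cone G -> cone (F + G).
Proof.
by case: k F G => [|k] F G; [rewrite /= mcoeffD; apply: PD|exact: nspan_add].
Qed.

Lemma cone_sum k n (F : 'I_n -> {mpoly R[k]}) :
  (forall i, cone (F i)) -> cone (\sum_(i < n) F i).
Proof.
move=> h; elim/big_ind: _ => // [|x y]; [exact: cone0|exact: coneD].
Qed.

Lemma cone_hins k j a (g : {mpoly R[k]}) : (j <= k)%N -> cone g -> cone (hins j a g).
Proof. by move=> jk cg; apply: nspan_gen; exists j, a, g. Qed.

Lemma cone_ind k (Q : {mpoly R[k.+1]} -> Prop) :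
  Q 0 -> (forall F G, Q F -> Q G -> Q (F + G)) ->
  (forall j a g, (j <= k)%N -> cone g -> Q (hins j a g)) ->
  forall F, cone F -> Q F.
Proof.
move=> Q0 QD Qi F; elim=> // x y [j [a [g [jk cg ->]]]] _ Qy.
by apply: QD => //; apply: Qi.
Qed.

Lemma cone_C k c (F : {mpoly R[k]}) : P c -> cone F -> cone (c%:MP * F).
Proof.
move=> Pc; elim: k F => [|k IH] F; first by rewrite /= mul_mpolyC mcoeffZ; apply: PM.
elim/cone_ind=> [|G H cG cH|j a g jk cg]; first by rewrite mulr0; apply: cone0.
  by rewrite mulrDr; apply: coneD.
by rewrite -hins_C; apply: cone_hins => //; apply: IH.
Qed.

Lemma cone_q1 k (F : {mpoly R[k]}) : cone F -> cone ((q%:MP - 1) * F).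
Proof. by rewrite -[1]mpolyC1 -mpolyCB; apply: cone_C. Qed.

Lemma cone_q k (F : {mpoly R[k]}) : cone F -> cone (q%:MP * F).
Proof. by apply: cone_C; rewrite -[q](subrK 1); apply: PD. Qed.

(** The exponent is positive because the cancellation in [hrot_hins_ge] requires it. Both
    commutation rules return positive exponents on one variable fewer, so the induction closes. *)
Lemma cone_hrot k j i (F : {mpoly R[k.+1]}) : (j <= k)%N -> cone F -> cone (hrot j i.+1 F).
Proof.
elim: k j i F => [|k IH] j i F jk.
  elim/cone_ind=> [|G H cG cH|l a g]; first by rewrite hrot0; apply: cone0.
    by rewrite hrotD; apply: coneD.
  by rewrite leqn0 => /eqP -> cg; rewrite hrot_hins_last; apply: cone_hins.
elim/cone_ind=> [|G H cG cH|l a g]; first by rewrite hrot0; apply: cone0.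
  by rewrite hrotD; apply: coneD.
rewrite leq_eqVlt => /orP[/eqP -> cg|lk cg].
  by rewrite hrot_hins_last; apply: cone_hins.
case: (leqP j l) => jl.
  rewrite hrot_hins_ge //; apply: coneD.
    by apply: cone_q; apply: cone_hins => //; apply: IH => //; exact: (leq_trans jl lk).
  apply: cone_q1; apply: cone_sum => m; apply: cone_hins => //; exact: IH.
case: j jk jl => [//|j] jk jl; rewrite hrot_hins_lt //; apply: coneD.
  by apply: cone_hins; [exact: ltnW|exact: IH].
apply: cone_q1; apply: cone_sum => m; apply: cone_hins => //; exact: IH.
Qed.

(** The symmetric [w k.+1 r] passes through every T, and [w_up] then splits off the inserted
    variable with positive coefficients. *)
Lemma hins_w k j a r (g : {mpoly R[k]}) : (j <= k)%N ->
  w k.+1 r * hins j a g = hins j a (w k r * g) + (q%:MP - 1) *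
    \sum_(i < r) q%:MP ^+ i * hins j (a + i.+1) (w k (r - i.+1) * g).
Proof.
move=> jk; rewrite /hins {1}/hrot -hcycle_Ml //; last first.
  by move=> i G ij; apply: heckeS_Ml => [|b c _ _]; [lia|apply/issymP].
rewrite w_up [in LHS]mulrDl hcycleD // mwidenM; congr (_ + _).
  by rewrite /hrot mulrCA.
rewrite -[1]mpolyC1 -mpolyCB -mulrA hcycle_C //; congr (_ * _).
rewrite mulr_suml hcycle_sum //; apply: eq_bigr => i _.
rewrite -rmorphXn -!mulrA hcycle_C // /hrot mwidenM; congr (_ * hcycle _ _ _).
by rewrite addnC exprD -!mulrA; congr (_ * _); rewrite mulrCA.
Qed.

Lemma cone_qn k n (F : {mpoly R[k]}) : cone F -> cone (q%:MP ^+ n * F).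
Proof.
by move=> cF; elim: n => [|n IH]; rewrite ?mul1r // exprS -mulrA; apply: cone_q.
Qed.

Lemma cone_w k r (F : {mpoly R[k]}) : cone F -> cone (w k r * F).
Proof.
elim: k r F => [|k IH] r F.
  by move=> PF; rewrite /= rmorphM; exact: (PM (Pw r) PF).
elim/cone_ind=> [|G H cG cH|j a g jk cg]; first by rewrite mulr0; apply: cone0.
  by rewrite mulrDr; apply: coneD.
rewrite hins_w //; apply: coneD; first by apply: cone_hins => //; apply: IH.
apply: cone_q1; apply: cone_sum => i; apply: cone_qn.
by apply: cone_hins => //; apply: IH.
Qed.

Lemma cone_lowering k (F : {mpoly R[k.+1]}) : cone F -> cone (lowering F).
Proof.
elim: k F => [|k IH] F; elim/cone_ind=> [|G H cG cH|j a g jk cg];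
    rewrite ?lowering0 ?loweringD; try exact: cone0; try exact: coneD.
  by move: jk; rewrite leqn0 => /eqP ->; rewrite lowering_hins_last; apply: cone_w.
move: jk; rewrite leq_eqVlt => /orP[/eqP ->|jk].
  by rewrite lowering_hins_last; apply: cone_w.
rewrite lowering_hins //; apply: coneD; first by apply: cone_hins => //; apply: IH.
by apply: cone_q1; apply: cone_sum => p; apply: cone_w; apply: cone_hrot.
Qed.

End Lowering.

(** * The operators d_-, d_+ and phi *)

Lemma nat_Qqt n : n.+1%:R != 0 :> Qqt.
Proof.
rewrite -(rmorph_nat (@tofrac _)) tofrac_eq0 -(rmorph_nat (@mpolyC 2 rat)).
by rewrite mpolyC_eq0 Num.Theory.pnatr_eq0.
Qed.

Lemma q_neq1 : q - 1 != 0.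
Proof.
have U0 : (U_(ord0)%MM == 0%MM :> 'X_{1..2}) = false.
  by apply/eqP => /mnmP /(_ ord0); rewrite mnm1E mnm0E.
rewrite -tofrac1 -tofracB tofrac_eq0; apply/eqP => /mpolyP /(_ 0%MM).
rewrite mcoeffB mcoeffX mcoeff1 eqxx mcoeff0 U0 sub0r => /eqP.
by rewrite oppr_eq0 oner_eq0.
Qed.

Definition scal_rm k : {rmorphism Qqt -> {mpoly Lambda[k]}} :=
  @mpolyC k Lambda \o in_alg Lambda.

Arguments scal_rm k : simpl never.

Lemma scalE k x : scal k x = scal_rm k x.
Proof. by []. Qed.

Definition pleth_psum k (eps : Qqt) (y : {mpoly Lambda[k]}) r : {mpoly Lambda[k]} :=
  (p_S r)%:MP + scal_rm k (eps * (q ^+ r.+1 - 1)) * y ^+ r.+1.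

Lemma psum_generates (f : Lambda) : exists N (P : {mpoly Qqt[N]}),
  f = mmap (fun c => c%:A) (fun r : 'I_N => p_S r) P.
Proof. exact: (psum_generated nat_Qqt f). Qed.

(** Every polynomial in the power sums that represents [f] gives the value of the homomorphism, and
    one exists; so the choice made by [xget] is immaterial. *)
Lemma plethLE k eps (y : V_ k) :
  plethL eps y = psum_subst nat_Qqt (scal_rm k) (pleth_psum eps y)
    :> (Lambda -> {mpoly Lambda[k]}).
Proof.
apply: funext => f; rewrite /plethL.
case: xgetP => [g _ [N [P [-> ->]]]|no].
  exact/esym/(psum_subst_peval nat_Qqt (scal_rm k) (pleth_psum eps y) P).
have [N [P fP]] := psum_generates f.
by exfalso; apply: no; exists N, P; split; [exact: fP|].
Qed.

Lemma pleth_mmap k eps (y : V_ k) F :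
  pleth eps y F
  = mmap (psum_subst nat_Qqt (scal_rm k) (pleth_psum eps y)) (fun i => 'X_i) F.
Proof. by rewrite /pleth plethLE. Qed.

Fact pleth_sealed k eps (y : {mpoly Lambda[k]}) :
  {f : {rmorphism {mpoly Lambda[k]} -> {mpoly Lambda[k]}} |
    [/\ forall F, pleth eps y F = f F,
        forall x, f x%:MP = psum_subst nat_Qqt (scal_rm k) (pleth_psum eps y) x &
        forall i, f 'X_i = 'X_i]}.
Proof.
exists (mmap (psum_subst nat_Qqt (scal_rm k) (pleth_psum eps y)) (fun i => 'X_i)).
split=> [F|x|i]; [exact: pleth_mmap|exact: mmapC|exact: etrans (mmapX _ _ _) (mmap1U _ _)].
Qed.

Definition pleth_rm k eps y := sval (@pleth_sealed k eps y).

Lemma pleth_rmE k eps (y : V_ k) F : pleth eps y F = pleth_rm eps y F.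
Proof. by have [h _ _] := svalP (pleth_sealed eps y). Qed.

Lemma pleth_rmC k eps y x :
  @pleth_rm k eps y x%:MP = psum_subst nat_Qqt (scal_rm k) (pleth_psum eps y) x.
Proof. by have [_ h _] := svalP (pleth_sealed eps y). Qed.

Lemma pleth_rmX k eps y i : @pleth_rm k eps y 'X_i = 'X_i.
Proof. by have [_ _ h] := svalP (pleth_sealed eps y). Qed.

(* Image of p_(r+1) under X |-> X - (q - 1)(y_1 + ... + y_k), y_i = - 'X_(i-1). *)
Definition twist_psum k r : {mpoly Lambda[k]} :=
  (p_S r)%:MP - scal_rm k (q ^+ r.+1 - 1) * \sum_(i < k) (- 'X_i) ^+ r.+1.

Definition twistL k : {rmorphism Lambda -> {mpoly Lambda[k]}} :=
  psum_subst nat_Qqt (scal_rm k) (@twist_psum k).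

Fact twist_sealed k : {f : {rmorphism {mpoly Lambda[k]} -> {mpoly Lambda[k]}} |
  (forall x, f x%:MP = twistL k x) /\ (forall i, f 'X_i = - 'X_i)}.
Proof.
exists (mmap (twistL k) (fun i => - 'X_i)).
by split=> [x|i]; [exact: mmapC|exact: etrans (mmapX _ _ _) (mmap1U _ _)].
Qed.

Definition twist k := sval (twist_sealed k).

Lemma twistLA k x : twistL k x%:A = scal_rm k x.
Proof. exact: psum_substA. Qed.

Lemma twistL_psum k r : twistL k (p_S r) = twist_psum k r.
Proof. exact: psum_subst_psum. Qed.


Lemma twistC k x : twist k x%:MP = twistL k x.
Proof. by have [h _] := svalP (twist_sealed k). Qed.

Lemma twistX k i : twist k 'X_i = - 'X_i.
Proof. by have [_ h] := svalP (twist_sealed k). Qed.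

Lemma twist_scal k x : twist k (scal_rm k x) = scal_rm k x.
Proof. exact: etrans (twistC _ _) (twistLA _ _). Qed.


(** The substitution X + (q - 1) y_(k+1) cancels the last summand of the twist in k + 1 variables.
    Both sides are ring homomorphisms, so power sums, scalars and variables suffice. *)
Lemma twist_pleth k (F : {mpoly Lambda[k]}) :
  twist k.+1 (pleth_rm 1 'X_ord_max (mwiden F)) = mwiden (twist k F).
Proof.
pose f : {rmorphism _ -> {mpoly Lambda[k.+1]}} :=
  twist k.+1 \o pleth_rm 1 'X_ord_max \o @mwiden k Lambda.
pose g : {rmorphism _ -> {mpoly Lambda[k.+1]}} := @mwiden k Lambda \o twist k.
suff e : f =1 g by exact: e.
apply: mpoly_rmorph_ext => [x|i].
  change (twist k.+1 (pleth_rm 1 'X_ord_max (mwiden x%:MP)) = mwiden (twist k x%:MP)).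
  rewrite mwidenC.
  rewrite pleth_rmC.
  rewrite twistC.
  pose f1 : {rmorphism Lambda -> {mpoly Lambda[k.+1]}} :=
    twist k.+1 \o psum_subst nat_Qqt (scal_rm k.+1) (pleth_psum 1 'X_ord_max).
  pose g1 : {rmorphism Lambda -> {mpoly Lambda[k.+1]}} := @mwiden k Lambda \o twistL k.
  suff e : f1 =1 g1 by exact: e.
  apply: (symfun_rmorph_ext nat_Qqt) => [a|r].
    change (twist k.+1 (psum_subst nat_Qqt (scal_rm k.+1) (pleth_psum 1 'X_ord_max) a%:A)
      = mwiden (twistL k a%:A)).
    by rewrite psum_substA twist_scal twistLA mwidenC.
  change (twist k.+1 (psum_subst nat_Qqt (scal_rm k.+1) (pleth_psum 1 'X_ord_max) (p_S r))
    = mwiden (twistL k (p_S r))).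
  rewrite psum_subst_psum twistL_psum /pleth_psum /twist_psum.
  rewrite rmorphD rmorphM rmorphXn twistC twistX twist_scal twistL_psum /twist_psum.
  rewrite mwidenB mwidenM !mwidenC mul1r raddf_sum big_ord_recr /=.
  have -> : \sum_(i < k) mwiden ((- 'X_i) ^+ r.+1 : {mpoly Lambda[k]}) =
      \sum_(i < k) (- 'X_(widen_ord (leqnSn k) i)) ^+ r.+1.
    by apply: eq_bigr => i _; rewrite rmorphXn /= mwidenN mwiden_Xi.
  by rewrite mulrDr opprD addrA subrK.
change (twist k.+1 (pleth_rm 1 'X_ord_max (mwiden 'X_i)) = mwiden (twist k 'X_i)).
by rewrite twistX mwidenN mwiden_Xi pleth_rmX twistX.
Qed.

Lemma msym_twistL k (s : 'S_k) f : msym s (twistL k f) = twistL k f.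
Proof.
pose g : {rmorphism Lambda -> {mpoly Lambda[k]}} := msym s \o twistL k.
suff e : g =1 twistL k by exact: e.
apply: (symfun_rmorph_ext nat_Qqt) => [a|r].
  change (msym s (twistL k a%:A) = twistL k a%:A).
  by rewrite twistLA msymC.
change (msym s (twistL k (p_S r)) = twistL k (p_S r)).
rewrite twistL_psum /twist_psum msymB msymM !msymC; congr (_ - _ * _).
rewrite raddf_sum [RHS](reindex_inj (@perm_inj _ s)); apply: eq_bigr => i _ /=.
by rewrite rmorphXn /= msymN msymXi.
Qed.

Lemma twist_msym k (s : 'S_k) F : twist k (msym s F) = msym s (twist k F).
Proof.
pose f : {rmorphism _ -> {mpoly Lambda[k]}} := twist k \o msym s.
pose g : {rmorphism _ -> {mpoly Lambda[k]}} := msym s \o twist k.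
suff e : f =1 g by exact: e.
apply: mpoly_rmorph_ext => [x|i].
  change (twist k (msym s x%:MP) = msym s (twist k x%:MP)).
  by rewrite msymC !twistC msym_twistL.
change (twist k (msym s 'X_i) = msym s (twist k 'X_i)).
by rewrite msymXi !twistX msymN msymXi.
Qed.

Definition qLambda : Lambda := in_alg Lambda q.

(** T is homogeneous of degree 0, so changing the sign of all variables preserves its defining
    equation. *)
Lemma hecke_neg (K : comNzRingType) (q a b h f s : K) :
  (- b - - a) * h = (q - 1) * - a * f + (- b - q * - a) * s ->
  (b - a) * h = (q - 1) * a * f + (b - q * a) * s.
Proof. by move=> e; apply: (eq_of_subr (congr1 -%R e)); ring. Qed.

Lemma twist_hecke k (a b : 'I_k) F : a != b ->
  twist k (hecke qLambda a b F) = hecke qLambda a b (twist k F).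
Proof.
move=> ab; apply/esym/heckeP => //.
have cq : twist k qLambda%:MP = qLambda%:MP by apply: twist_scal.
have := congr1 (twist k) (heckeE qLambda a b F).
rewrite !(rmorphM, rmorphB, rmorphD) /= !rmorph1 !twistX cq twist_msym => e.
exact: hecke_neg e.
Qed.

Lemma T_heckeE k (i : 'I_k) (F : {mpoly Lambda[k.+1]}) :
  T_ i F = hecke qLambda (widen_ord (leqnSn k) i) (lift ord0 i) F.
Proof.
set a := widen_ord _ _; set b := lift _ _.
have ab : a != b by rewrite -val_eqE /= /bump /= add1n ltn_eqF.
have sq1 : scal k.+1 (q - 1) = qLambda%:MP - 1.
  by rewrite scalE rmorphB rmorph1.
rewrite /T_ /quotV; case: xgetP => [G _ /= e|no].
  apply/esym/heckeP => //; rewrite e -/a -/b sq1; congr (_ + _).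
exfalso; apply: (no (hecke qLambda a b F)) => /=.
by rewrite heckeE -/a -/b sq1.
Qed.

Lemma twist_T k (i : 'I_k) (F : {mpoly Lambda[k.+1]}) :
  twist k.+1 (T_ i F) = heckeS qLambda i (twist k.+1 F).
Proof.
have h : (i.+1 < k.+1)%N by rewrite ltnS.
rewrite T_heckeE twist_hecke; last by rewrite -val_eqE /= /bump /= add1n ltn_eqF.
by rewrite (heckeS_ord qLambda (ltnW h) h); congr hecke; apply: val_inj.
Qed.

Lemma twist_d_plus k (F : {mpoly Lambda[k]}) :
  twist k.+1 (d_plus F) = hins qLambda 0 0 (twist k F).
Proof.
rewrite /d_plus pleth_rmE /hins /hrot mul1r -twist_pleth /hcycle subn0 -val_enum_ord.
move: (pleth_rm _ _ _) => G; elim: (enum 'I_k) => //= i s IH.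
by rewrite twist_T IH.
Qed.

Lemma coef_comp_oppX (R : comNzRingType) (p : {poly R}) j :
  (p \Po (- 'X))`_j = (-1) ^+ j * p`_j.
Proof.
have -> : p \Po (- 'X) = \poly_(i < size p) ((-1) ^+ i * p`_i).
  rewrite comp_polyE poly_def; apply: eq_bigr => i _.
  by rewrite -scaleN1r exprZn scalerA mulrC.
rewrite coef_poly; case: ltnP => // h.
by rewrite nth_default // mulr0.
Qed.

(** The twist in k + 1 variables factors: the substitution X - (q - 1) y_(k+1) of d_-, then the
    twist in [k] variables on the coefficients, then the sign change of the last variable. *)
Lemma muni_twist k (F : {mpoly Lambda[k.+1]}) :
  muni (twist k.+1 F)
  = map_poly (twist k) (muni (pleth_rm (-1) 'X_ord_max F)) \Po (- 'X).
Proof.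
pose f : {rmorphism _ -> {poly {mpoly Lambda[k]}}} := @muni k Lambda \o twist k.+1.
pose g : {rmorphism _ -> {poly {mpoly Lambda[k]}}} :=
  comp_poly (- 'X) \o (map_poly (twist k) \o (@muni k Lambda \o pleth_rm (-1) 'X_ord_max)).
suff e : f =1 g by exact: e.
have muniX i : muni 'X_(widen_ord (leqnSn k) i) = ('X_i)%:P :> {poly {mpoly Lambda[k]}}.
  by rewrite -mwiden_Xi muni_widen.
apply: mpoly_rmorph_ext => [x|i].
  change (muni (twist k.+1 x%:MP) =
    map_poly (twist k) (muni (pleth_rm (-1) 'X_ord_max x%:MP)) \Po (- 'X)).
  rewrite twistC pleth_rmC.
  pose f1 : {rmorphism Lambda -> {poly {mpoly Lambda[k]}}} :=
    @muni k Lambda \o twistL k.+1.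
  pose g1 : {rmorphism Lambda -> {poly {mpoly Lambda[k]}}} :=
    comp_poly (- 'X) \o (map_poly (twist k) \o (@muni k Lambda \o
      psum_subst nat_Qqt (scal_rm k.+1) (pleth_psum (-1) 'X_ord_max))).
  suff e : f1 =1 g1 by exact: e.
  apply: (symfun_rmorph_ext nat_Qqt) => [a|r].
    change (muni (twistL k.+1 a%:A) = map_poly (twist k) (muni
      (psum_subst nat_Qqt (scal_rm k.+1) (pleth_psum (-1) 'X_ord_max) a%:A)) \Po (- 'X)).
    rewrite twistLA psum_substA muniC map_polyC comp_polyC; congr _%:P.
    exact/esym/twist_scal.
  change (muni (twistL k.+1 (p_S r)) = map_poly (twist k) (muni
      (psum_subst nat_Qqt (scal_rm k.+1) (pleth_psum (-1) 'X_ord_max) (p_S r))) \Po (- 'X)).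
  rewrite twistL_psum psum_subst_psum /twist_psum /pleth_psum.
  have muniXn : muni (('X_ord_max : {mpoly Lambda[k.+1]}) ^+ r.+1) = 'X ^+ r.+1.
    by rewrite rmorphXn /= muni_last.
  have scN b : scal_rm k (-1 * b) = - scal_rm k b.
    by rewrite (_ : -1 * b = - b) ?rmorphN //; rewrite mulNr mul1r.
  have muni_sc b : muni (scal_rm k.+1 b) = (scal_rm k b)%:P by exact: muniC.
  have -> : muni ((p_S r)%:MP_[k.+1] - scal_rm k.+1 (q ^+ r.+1 - 1) *
        \sum_(i < k.+1) (- 'X_i) ^+ r.+1)
      = (twist_psum k r)%:P - (scal_rm k (q ^+ r.+1 - 1))%:P * (- 'X) ^+ r.+1.
    rewrite muniB muniM muni_sc muniC raddf_sum big_ord_recr /=.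
    rewrite rmorphXn /= muniN muni_last mulrDr opprD addrA; congr (_ - _).
    rewrite /twist_psum polyCB polyCM; congr (_ - _ * _).
    rewrite raddf_sum; apply: eq_bigr => i _.
    rewrite rmorphXn [RHS]rmorphXn; congr (_ ^+ _).
    change (muni (- 'X_(widen_ord (leqnSn k) i)) = (- 'X_i)%:P :> {poly {mpoly Lambda[k]}}).
    by rewrite muniN muniX polyCN.
  have -> : muni ((p_S r)%:MP_[k.+1] + scal_rm k.+1 (-1 * (q ^+ r.+1 - 1)) *
        'X_ord_max ^+ r.+1)
      = (p_S r)%:MP%:P - (scal_rm k (q ^+ r.+1 - 1))%:P * 'X ^+ r.+1.
    rewrite muniD muniM muni_sc muniC muniXn.
    by rewrite scN polyCN mulNr.
  have mapE (c : {mpoly Lambda[k]}) p : map_poly (twist k) (p%:P - c%:P * 'X ^+ r.+1)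
      = (twist k p)%:P - (twist k c)%:P * 'X ^+ r.+1.
    by rewrite rmorphB rmorphM rmorphXn /= !map_polyC map_polyX.
  have compE (c p : {mpoly Lambda[k]}) : (p%:P - c%:P * 'X ^+ r.+1) \Po (- 'X)
      = p%:P - c%:P * (- 'X) ^+ r.+1.
    by rewrite rmorphB rmorphM rmorphXn /= !comp_polyC comp_polyX.
  by rewrite mapE compE twistC twistL_psum twist_scal.
change (muni (twist k.+1 'X_i) =
    map_poly (twist k) (muni (pleth_rm (-1) 'X_ord_max 'X_i)) \Po (- 'X)).
rewrite twistX pleth_rmX muniN.
have [->|[j ->]] : i = ord_max \/ exists j, i = widen_ord (leqnSn k) j.
- have [lt|ge] := ltnP i k.
    by right; exists (Ordinal lt); apply: val_inj.
  by left; apply: val_inj => /=; have := ltn_ord i; lia.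
- by rewrite muni_last map_polyX comp_polyX.
by rewrite muniX map_polyC comp_polyC -polyCN; congr _%:P; apply/esym/twistX.
Qed.

Definition twist_elem k j : {mpoly Lambda[k]} := twistL k (e_ j).

Lemma twist_term k j x (c : {mpoly Lambda[k]}) :
  twist k ((-1) ^+ j * x%:MP * c) = (-1) ^+ j * twistL k x * twist k c.
Proof. by rewrite 2!rmorphM rmorphXn rmorphN1 twistC. Qed.

Lemma opp_signS (K : comNzRingType) j (x y : K) :
  - ((-1) ^+ j.+1 * x * y) = x * ((-1) ^+ j * y).
Proof. by rewrite exprS; move: (_ ^+ j) => a; ring. Qed.

(** The outer minus sign, the (-1)^(j+1) in front of e_(j+1) and the (-1)^j from the sign change of
    the last variable cancel. *)
Lemma twist_d_minus k (F : {mpoly Lambda[k.+1]}) :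
  twist k (d_minus F) = lowering twist_elem (twist k.+1 F).
Proof.
rewrite /d_minus pleth_rmE; set G := pleth_rm _ _ F.
have mE j : (muni (twist k.+1 F))`_j = (-1) ^+ j * twist k (muni G)`_j.
  by rewrite muni_twist coef_comp_oppX coef_map.
have sz : (size (muni (twist k.+1 F)) <= size (muni G))%N.
  apply/leq_sizeP => j h; rewrite mE nth_default // rmorph0 mulr0 //.
clearbody G; rewrite (lowering_bound _ sz).
apply: etrans (rmorphN (twist k) _) _; rewrite rmorph_sum -sumrN.
apply: eq_bigr => j _; apply: etrans (congr1 -%R (twist_term _ _ _)) _.
apply: etrans (opp_signS _ _ _) _.
congr (_ * _).
exact: esym (mE _).
Qed.

Lemma twist_elem0 k : twist_elem k 0 = 1.
Proof. by rewrite /twist_elem /e_; have [-> _] := newton_elem Qqt; rewrite rmorph1. Qed.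

Lemma twist_elem_sym k j : twist_elem k j \is symmetric.
Proof. by apply/issymP => s; apply: msym_twistL. Qed.

Lemma mwiden_twist_psum k r : mwiden (twist_psum k r) = (p_S r)%:MP
  - scal_rm k.+1 (q ^+ r.+1 - 1) * \sum_(i < k) (- 'X_(widen_ord (leqnSn k) i)) ^+ r.+1.
Proof.
have e i : mwiden ((- 'X_i) ^+ r.+1 : {mpoly Lambda[k]})
    = (- 'X_(widen_ord (leqnSn k) i)) ^+ r.+1.
  by rewrite rmorphXn /= mwidenN mwiden_Xi.
rewrite /twist_psum mwidenB mwidenM !mwidenC raddf_sum; congr (_ - _ * _).
by apply: eq_bigr => i _; exact: e.
Qed.

Lemma twist_psumS k r : twist_psum k.+1 r = (p_S r)%:MP - scal_rm k.+1 (q ^+ r.+1 - 1)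
  * (\sum_(i < k) (- 'X_(widen_ord (leqnSn k) i)) ^+ r.+1 + (- 'X_ord_max) ^+ r.+1).
Proof. by rewrite /twist_psum big_ord_recr. Qed.

Lemma twist_psum_identity (K : comNzRingType) (p a S b : K) :
  p - (a - 1) * (S + b) + a * b = p - (a - 1) * S + b.
Proof. ring. Qed.

(** Multiplying the generating series in k + 1 variables by 1 - q x z, and the one in [k] variables
    by 1 - x z, gives the same power sums, since -(q^r - 1) + q^r = 1. In characteristic zero the
    coefficients then agree. *)
Lemma twist_elem_rec k j :
  twist_elem k.+1 j.+1 - qLambda%:MP * xvar _ k.+1 k * twist_elem k.+1 j
  = mwiden (twist_elem k j.+1) - xvar _ k.+1 k * mwiden (twist_elem k j).
Proof.
rewrite xvar_last; pose x : {mpoly Lambda[k.+1]} := 'X_ord_max.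
have h1 := newton_mulX (- (qLambda%:MP * x))
  (newton_rmorph (twistL k.+1) (newton_elem Qqt)).
pose wg : {rmorphism Lambda -> {mpoly Lambda[k.+1]}} := @mwiden k Lambda \o twistL k.
have h2 := newton_mulX (- x) (newton_rmorph wg (newton_elem Qqt)).
have scaleX r : (- (qLambda%:MP * x)) ^+ r.+1 = scal_rm k.+1 (q ^+ r.+1) * (- x) ^+ r.+1.
  by rewrite -mulrN exprMn; congr (_ * _); apply: esym (rmorphXn (scal_rm k.+1) r.+1 q).
have scaleB r : scal_rm k.+1 (q ^+ r.+1 - 1) = scal_rm k.+1 (q ^+ r.+1) - 1.
  by rewrite rmorphB rmorph1.
have ep : (fun i => (twistL k.+1 \o psum Qqt) i + (- (qLambda%:MP * x)) ^+ i.+1)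
    = (fun i => (wg \o psum Qqt) i + (- x) ^+ i.+1).
  apply: funext => r.
  change (twistL k.+1 (p_S r) + (- (qLambda%:MP * x)) ^+ r.+1
    = mwiden (twistL k (p_S r)) + (- x) ^+ r.+1).
  rewrite !twistL_psum mwiden_twist_psum twist_psumS scaleX scaleB.
  exact: twist_psum_identity.
move: h1; rewrite ep => h1.
have e := newton_eq_elem (nat_lreg nat_Qqt (scal_rm k.+1)) h1 h2 j.+1.
rewrite -mulNr.
have {e} e : twist_elem k.+1 j.+1 + - (qLambda%:MP * x) * twist_elem k.+1 j
  = mwiden (twist_elem k j.+1) + - x * mwiden (twist_elem k j) by exact: e.
by rewrite e mulNr.
Qed.

(** For j = a = 0 the sum in [lowering_hins] has a single term, with coefficient w_0 = 1, so the
    commutator is exactly q - 1 times the right side. *)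
Lemma twist_phi k (F : {mpoly Lambda[k.+1]}) :
  twist k.+1 (phi F) = hrot qLambda 0 1 (twist k.+1 F).
Proof.
have sB : scal_rm k.+1 (q - 1) = scal_rm k.+1 q - 1 by rewrite rmorphB rmorph1.
have h : twist k.+1 (d_minus (d_plus F) - d_plus (d_minus F))
    = scal_rm k.+1 (q - 1) * hrot qLambda 0 1 (twist k.+1 F).
  apply: etrans (rmorphB (twist k.+1) _ _) _.
  rewrite twist_d_minus !twist_d_plus twist_d_minus.
  rewrite (lowering_hins twist_elem0 twist_elem_sym twist_elem_rec) //.
  rewrite big_ord1 /= twist_elem0 mul1r.
  rewrite addrC addKr; congr (_ * _).
  exact: esym sB.
apply: etrans (rmorphM (twist k.+1) _ _) _.
apply: etrans (congr2 *%R (twist_scal _ _) h) _.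
by rewrite mulrA -rmorphM mulVf ?q_neq1 // rmorph1 mul1r.
Qed.

(** * e-positivity *)

Lemma Nqt0 : Nqt 0.
Proof. by exists 0; [exact: mpolyOver0|rewrite tofrac0]. Qed.

Lemma Nqt1 : Nqt 1.
Proof. by exists 1; [rewrite mpolyOverC|rewrite tofrac1]. Qed.

Lemma NqtD x y : Nqt x -> Nqt y -> Nqt (x + y).
Proof.
move=> [p /mpolyOverP Pp ->] [r /mpolyOverP Pr ->].
by exists (p + r); [apply/mpolyOverP => m; rewrite mcoeffD rpredD|rewrite tofracD].
Qed.

Lemma NqtM x y : Nqt x -> Nqt y -> Nqt (x * y).
Proof.
move=> [p /mpolyOverP Pp ->] [r /mpolyOverP Pr ->].
exists (p * r); last by rewrite tofracM.
by apply/mpolyOverP => m; rewrite mcoeffM rpred_sum // => i _; rewrite rpredM.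
Qed.

Lemma Nqt_q : Nqt q.
Proof.
exists 'X_ord0 => //; apply/mpolyOverP => m; rewrite mcoeffX.
by case: (_ == m).
Qed.

Fact shift_q_zmod : zmod_morphism shift_q.
Proof. by move=> f g; apply: symfun_inj => n /=; rewrite raddfB. Qed.
Fact shift_q_monoid : monoid_morphism shift_q.
Proof.
split=> [|f g]; apply: symfun_inj => n /=; last by rewrite rmorphM.
rewrite map_mpolyC; congr (_%:MP); exact: (rmorph1 shift_frac).
Qed.
HB.instance Definition _ :=
  GRing.isZmodMorphism.Build Lambda Lambda shift_q shift_q_zmod.
HB.instance Definition _ :=
  GRing.isMonoidMorphism.Build Lambda Lambda shift_q shift_q_monoid.

Lemma shift_qZ c f : shift_q (c *: f) = shift_frac c *: shift_q f.
Proof. by apply: symfun_inj => n /=; rewrite map_mpolyZ. Qed.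

Lemma shift_q_e r : shift_q (e_ r) = e_ r.
Proof.
apply: symfun_inj => n /=; apply/mpolyP => m.
by rewrite mcoeff_map_mpoly /= !mcoeff_mesym rmorph_nat.
Qed.

Lemma shift_q_q1 : shift_frac (q - 1) = q.
Proof.
have e : shift_frac q = q + 1.
  by rewrite /q shift_frac_tofrac /shift_poly comp_mpolyXU /= tofracD tofrac1.
have e' : shift_frac (q - 1) = shift_frac q - shift_frac 1 by exact: rmorphB.
have e1 : shift_frac 1 = 1 by exact: rmorph1.
by rewrite e' e1 e addrK.
Qed.

(* Unlike in [e_positive], the products of e_r need not be sorted or distinct. *)
Definition shift_positive (f : Lambda) : Prop :=
  exists2 l : seq (Qqt * seq nat), (forall x, x \in l -> Nqt x.1) &
    shift_q f = \sum_(x <- l) x.1 *: e_part x.2.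

Lemma shift_positive0 : shift_positive 0.
Proof. by exists [::]; rewrite // rmorph0 big_nil. Qed.

Lemma shift_positive_term (f : Lambda) c mu :
  Nqt c -> shift_q f = c *: e_part mu -> shift_positive f.
Proof.
move=> Nc e; exists [:: (c, mu)]; last by rewrite big_seq1.
by move=> x; rewrite inE => /eqP ->.
Qed.

Lemma e_part_nil : e_part [::] = 1.
Proof. exact: big_nil. Qed.

Lemma shift_positive1 : shift_positive 1.
Proof.
by apply: (shift_positive_term (mu := [::]) Nqt1); rewrite rmorph1 e_part_nil scale1r.
Qed.

Lemma shift_positiveD f g :
  shift_positive f -> shift_positive g -> shift_positive (f + g).
Proof.
move=> [l lN le] [m mN me]; exists (l ++ m) => [x|].
  by rewrite mem_cat => /orP[/lN|/mN].
by rewrite rmorphD big_cat /= le me.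
Qed.

Lemma shift_positiveM f g :
  shift_positive f -> shift_positive g -> shift_positive (f * g).
Proof.
move=> [l lN le] [m mN me].
exists [seq (x.1 * y.1, x.2 ++ y.2) | x <- l, y <- m] => [z|].
  by move=> /allpairsP[[x y] [/= xl ym ->]]; apply: NqtM; [apply: lN|apply: mN].
rewrite rmorphM /= le me big_allpairs_dep mulr_suml; apply: eq_bigr => x _.
rewrite mulr_sumr; apply: eq_bigr => y _ /=.
by rewrite /e_part big_cat /= -scalerAl -scalerAr scalerA.
Qed.

Lemma shift_positive_q1 : shift_positive (qLambda - 1).
Proof.
apply: (shift_positive_term (mu := [::]) Nqt_q).
have -> : qLambda - 1 = (q - 1) *: (1 : Lambda) by rewrite scalerBl scale1r.
by rewrite shift_qZ shift_q_q1 rmorph1 e_part_nil.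
Qed.

Lemma shift_positive_e r : shift_positive (e_ r).
Proof.
apply: (shift_positive_term (mu := [:: r]) Nqt1).
by rewrite shift_q_e /e_part big_seq1 scale1r.
Qed.

Definition partition_of (mu : seq nat) := sort geq (filter (predC1 0%N) mu).

Lemma partition_ofP mu : is_partition (partition_of mu).
Proof.
rewrite /is_partition /partition_of sort_sorted /=; last first.
  by move=> a b; apply: leq_total.
by rewrite mem_sort mem_filter.
Qed.

Lemma e_part_partition mu : e_part (partition_of mu) = e_part mu.
Proof.
rewrite /e_part (perm_big (filter (predC1 0%N) mu)); last by rewrite perm_sort.
rewrite big_filter [RHS](bigID (predC1 0%N)) /=.
rewrite [X in _ = _ * X]big1 ?mulr1 // => r /negbNE /eqP ->.
by have [] := newton_elem Qqt.
Qed.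

(** Terms are grouped by the partition that their index becomes after sorting and removing zeros,
    which is harmless as e_0 = 1. *)
Lemma shift_positiveP f : shift_positive f -> e_positive (shift_q f).
Proof.
move=> [l lN ->].
pose s := undup [seq partition_of x.2 | x <- l].
pose c mu := \sum_(x <- l | partition_of x.2 == mu) x.1.
exists s, c; split=> [||mu _|]; first exact: undup_uniq.
- by apply/allP => mu; rewrite mem_undup => /mapP[x _ ->]; apply: partition_ofP.
- rewrite /c big_seq_cond; elim/big_ind: _ => [||x /andP[xl _]].
  + exact: Nqt0.
  + exact: NqtD.
  exact: lN.
under [RHS]eq_bigr => mu _ do rewrite /c scaler_suml big_mkcond.
rewrite exchange_big /= big_seq [RHS]big_seq; apply: eq_bigr => x xl.
rewrite (bigD1_seq (partition_of x.2)) ?undup_uniq //=; last first.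
  by rewrite mem_undup; apply/mapP; exists x.
rewrite eqxx e_part_partition big1 ?addr0 // => mu mux.
by rewrite eq_sym (negbTE mux).
Qed.

Local Notation pcone := (cone qLambda shift_positive).

Lemma twistL0 x : twistL 0 x = x%:MP.
Proof.
pose g : {rmorphism Lambda -> {mpoly Lambda[0]}} := @mpolyC 0 Lambda.
suff e : twistL 0 =1 g by exact: e.
apply: (symfun_rmorph_ext nat_Qqt) => [a|r].
  by change (twistL 0 a%:A = scal_rm 0 a); rewrite twistLA.
change (twistL 0 (p_S r) = (p_S r)%:MP).
by rewrite twistL_psum /twist_psum big_ord0 mulr0 subr0.
Qed.

Lemma twist_elem_positive j : shift_positive (twist_elem 0 j)@_0.
Proof. by rewrite /twist_elem twistL0 mcoeffC eqxx mulr1; apply: shift_positive_e. Qed.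

Lemma step_cone s k (F : {mpoly Lambda[k]}) : (s <> East -> 0 < k)%N ->
  pcone (twist k F) -> pcone (twist (step_deg s k) (@step_op s k F)).
Proof.
case: s => [] hk cF.
- case: k F hk cF => [|k] F hk cF; first by have /hk : North <> East by [].
  change (pcone (twist k (d_minus F))); rewrite twist_d_minus.
  exact: (cone_lowering twist_elem0 twist_elem_sym twist_elem_rec
    shift_positive0 shift_positive1
    shift_positiveD shift_positiveM shift_positive_q1 twist_elem_positive).
- case: k F hk cF => [|k] F hk cF; first by have /hk : Diag <> East by [].
  change (pcone (twist k.+1 (phi F))); rewrite twist_phi.
  exact: (cone_hrot shift_positive0 shift_positive1
    shift_positiveD shift_positiveM shift_positive_q1).
change (pcone (twist k.+1 (d_plus F))); rewrite twist_d_plus.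
exact: cone_hins.
Qed.

Lemma path_from_le a P : path_from a P -> (a.1 <= a.2)%N.
Proof. by case: P => [/eqP ->|s P /and3P[]]. Qed.

(** The last step acts first, so the induction is over suffixes of the path, and [a] is where the
    suffix starts. Its height above the diagonal counts the variables; the path conditions make it
    positive whenever d_- or phi is applied. *)
Lemma word_cone P a : path_from a P ->
  path_deg P 0 = (a.2 - a.1)%N /\ pcone (twist _ (@word_op P 0 (1 : Lambda)%:MP)).
Proof.
elim: P a => [|s P IH] a /=.
  move=> /eqP ->; rewrite subnn; split=> //.
  change (shift_positive (twist 0 (1 : Lambda)%:MP)@_0).
  by rewrite twistC twistL0 mcoeffC eqxx mulr1; apply: shift_positive1.
move=> /and3P[a12 nd pP]; have le := path_from_le pP.
have [eP cP] := IH _ pP; split.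
  by rewrite eP; case: s {cP IH eP} nd pP le => /= nd pP le; lia.
apply: step_cone => // sE; rewrite eP.
by case: s {cP IH eP} nd pP le sE => //= nd pP le _; lia.
Qed.

Lemma twist0_coef F : (twist 0 F)@_0 = F@_0.
Proof.
have -> : F = (F@_0)%:MP.
  apply/mpolyP => m; rewrite mcoeffC (_ : m = 0%MM) ?eqxx ?mulr1 //.
  by apply/mnmP => -[].
by rewrite twistC twistL0.
Qed.

(** The number of variables is tied to 0 by an equation because [path_deg P 0] equals 0 only
    propositionally. *)
Lemma cone_coef k (W : {mpoly Lambda[k]}) :
  k = 0%N -> pcone (twist k W) -> shift_positive W@_0.
Proof. by case: k W => // W _; rewrite -[in X in _ -> X]twist0_coef. Qed.

Unset Implicit Arguments.

Theorem theorem5p4 (P : seq step) (hP : in_P P) : e_positive (shift_q (d_path P 1)).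
Proof.
have [k0 cW] := word_cone hP.
by apply: shift_positiveP; exact: (cone_coef k0 cW).
Qed.
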